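(* Let $n\ge 1$ and let $\xi_0,\dots,\xi_n$ be independent real random variables with probability density functions $f_0,\dots,f_n$. Let $G(x)=\xi_nx^n+\dots+\xi_1x+\xi_0$, and let $\rho_k$, $1\le k\le n$, denote the $k$-th correlation function of the real zeros of $G$. Then for every $k\in\{1,\dots,n\}$ and $\mathbf{x}=(x_1,\dots,x_k)\in\mathbb{R}^k$, $$ \rho_k(\mathbf{x}) = \prod_{1\le i < j \le k} |x_i - x_j|\int_{\mathbb{R}^{n-k+1}} \prod_{i=0}^{n}f_i\left(\sum_{j=0}^{n-k}(-1)^{k-i+j}\sigma_{k-i+j}(\mathbf{x})\,t_j\right) \prod_{i=1}^k \left|\sum_{j=0}^{n-k} t_j x_i^j\right| \, dt_0\cdots dt_{n-k}. $$
   Context: With probability one all zeros of $G$ are simple. Let $\mu=\sum_{x\in\mathbb{R}:\,G(x)=0}\delta_x$ be the empirical measure counting the real zeros of $G$, where $\delta_x$ is the unit point mass at $x$. The correlation functions (joint intensities) of $\mu$ are functions $\rho_k:\mathbb{R}^k\to\mathbb{R}^+$, $k=1,\dots,n$, such that for any family of mutually disjoint Borel subsets $B_1,\dots,B_k\subset\mathbb{R}$, $$\mathbb{E}\left[\prod_{i=1}^{k}\mu(B_i)\right]=\int_{B_1}\cdots\int_{B_k}\rho_k(x_1,\dots,x_k)\,dx_1\cdots dx_k .$$ Since this property determines $\rho_k$ only up to Lebesgue-null sets, the formula for $\rho_k$ is understood to mean that the right-hand side is a version of the $k$-th correlation function, i.e. it satisfies this identity for all mutually disjoint Borel sets $B_1,\dots,B_k$.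 Elementary symmetric polynomials: for $\mathbf{x}\in\mathbb{R}^k$ and an integer $i$, $\sigma_i(\mathbf{x})=\sum_{1\le j_1<\dots<j_i\le k}x_{j_1}\cdots x_{j_i}$ if $0\le i\le k$ (so $\sigma_0=1$), and $\sigma_i(\mathbf{x})=0$ otherwise (i.e. for $i<0$ or $i>k$). An empty product equals $1$, and $x^0=1$ for all $x$. *)

(* Defs.v *)
From HB Require Import structures.
From mathcomp Require Import all_boot all_order all_algebra.
From mathcomp Require Import all_classical all_reals all_analysis.
From mathcomp Require Import measurable_realfun.

Set Implicit Arguments.
Unset Strict Implicit.
Unset Printing Implicit Defensive.

Import Order.TTheory GRing.Theory Num.Theory.
Import numFieldNormedType.Exports.

Local Open Scope classical_set_scope.
Local Open Scope ring_scope.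

Definition tcons (T : Type) (m : nat) (p : T * m.-tuple T) : m.+1.-tuple T :=
  [tuple of p.1 :: p.2].

Lemma measurable_tcons d (T : measurableType d) (m : nat) :
  measurable_fun [set: T * m.-tuple T] (@tcons T m).
Proof. exact: measurable_cons. Qed.

Section tuple_measure_cons.
Local Open Scope ereal_scope.
Context d (T : measurableType d) (R : realType) (m : nat).
Variables (mu : {sigma_finite_measure set T -> \bar R})
  (nu : {sigma_finite_measure set (m.-tuple T) -> \bar R}).

Definition tuple_measure_cons : set (m.+1.-tuple T) -> \bar R :=
  pushforward (mu \x nu) (@tcons T m).

Let preimage_tcons_measurable (A : set (m.+1.-tuple T)) :
  measurable A -> measurable (@tcons T m @^-1` A).
Proof. by move=> mA; rewrite -[X in measurable X]setTI; exact: measurable_tcons. Qed.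

Let tuple_measure_cons0 : tuple_measure_cons set0 = 0.
Proof. by rewrite /tuple_measure_cons /pushforward preimage_set0 measure0. Qed.

Let tuple_measure_cons_ge0 A : 0 <= tuple_measure_cons A.
Proof. by rewrite /tuple_measure_cons /pushforward measure_ge0. Qed.

Let tuple_measure_cons_sigma_additive : semi_sigma_additive tuple_measure_cons.
Proof.
move=> F mF tF mUF; rewrite /tuple_measure_cons /pushforward preimage_bigcup.
apply: measure_semi_sigma_additive.
- by move=> i; exact: preimage_tcons_measurable.
- apply/trivIsetP => /= i j _ _ ij; rewrite -preimage_setI.
  by move/trivIsetP : tF => /(_ _ _ _ _ ij) ->//; rewrite preimage_set0.
- by rewrite -preimage_bigcup; exact: preimage_tcons_measurable.
Qed.

HB.instance Definition _ := isMeasure.Build _ _ _ tuple_measure_cons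
  tuple_measure_cons0 tuple_measure_cons_ge0 tuple_measure_cons_sigma_additive.

Let tuple_measure_cons_sigma_finite : sigma_finite setT tuple_measure_cons.
Proof.
have /sigma_finiteP[F [TF ndF Foo]] := sigma_finiteT mu.
have /sigma_finiteP[G [TG ndG Goo]] := sigma_finiteT nu.
pose g (t : m.+1.-tuple T) : T * m.-tuple T := (thead t, [tuple of behead t]).
have mg : measurable_fun [set: m.+1.-tuple T] g.
  by apply: measurable_fun_pair; [exact: measurable_tnth|exact: measurable_behead].
have gK : cancel (@tcons T m) g.
  by move=> [x t]; rewrite /g /tcons; congr pair; apply: val_inj.
exists (fun i => g @^-1` (F i `*` G i)) => [|i].
  apply/seteqP; split=> // t _.
  have [i _ Fi] : (\bigcup_i F i) (g t).1 by rewrite -TF.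
  have [j _ Gj] : (\bigcup_i G i) (g t).2 by rewrite -TG.
  exists (maxn i j) => //; split.
    by move: Fi; exact/subsetPset/ndF/leq_maxl.
  by move: Gj; exact/subsetPset/ndG/leq_maxr.
have [mF Fi] := Foo i; have [mG Gi] := Goo i.
split; first by rewrite -[X in measurable X]setTI; apply: mg => //; exact: measurableX.
rewrite /tuple_measure_cons /pushforward (_ : _ @^-1` _ = F i `*` G i).
  by rewrite product_measure1E// lte_mul_pinfty// ge0_fin_numE.
by rewrite -comp_preimage (_ : g \o @tcons T m = id) ?preimage_id//; exact/funext/gK.
Qed.

HB.instance Definition _ := Measure_isSigmaFinite.Build _ _ _
  tuple_measure_cons tuple_measure_cons_sigma_finite.

End tuple_measure_cons.

(* Lebesgue measure on R^m, with R^m represented by m-tuples: the point mass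
   on the only element of R^0, and the image of the product measure on R x R^m
   under (x, t) |-> x :: t. *)
Fixpoint lebesgue_tuple (R : realType) (m : nat) :
    {sigma_finite_measure set (m.-tuple (measurableTypeR R)) -> \bar R} :=
  match m with
  | 0 => [the {sigma_finite_measure set _ -> \bar R} of
           dirac ([tuple] : 0.-tuple (measurableTypeR R))]
  | m'.+1 => [the {sigma_finite_measure set _ -> \bar R} of
           tuple_measure_cons (@lebesgue_measure R) (lebesgue_tuple R m')]
  end.

Lemma lebesgue_tuple_box (R : realType) (m : nat)
    (A : 'I_m -> set (measurableTypeR R)) : (forall i, measurable (A i)) ->
  (lebesgue_tuple R m [set t | forall i, A i (tnth t i)] =
   \prod_(i < m) lebesgue_measure (A i))%E.
Proof.
elim: m A => [|m IHm] A mA.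
  by rewrite big_ord0 /= diracE mem_set// => -[].
rewrite big_ord_recl -IHm//= /tuple_measure_cons /pushforward.
rewrite -product_measure1E//; last first.
  rewrite (_ : mkset _ = \bigcap_(i in [set: 'I_m])
      ((@tnth m (measurableTypeR R)) ^~ i @^-1` A (lift ord0 i))).
    apply: fin_bigcap_measurable => // i _.
    by rewrite -[X in measurable X]setTI; exact: measurable_tnth.
  by apply/seteqP; split => t /= h i => [_|]; exact: h.
congr (product_measure1 _ _ _); apply/seteqP; split => -[x t] /=.
  by move=> h; split=> [|i]; [exact: (h ord0)|have := h (lift ord0 i); rewrite tnthS].
by move=> [hx ht] i; case: (unliftP ord0 i) => [j ->|->//]; rewrite tnthS.
Qed.

Section random_variables.
Context d (T : measurableType d) (R : realType) (P : probability T R).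

Definition independent_RVs (I : finType) (X : I -> {RV P >-> R}) : Prop :=
  forall (J : {set I}) (A : I -> set R), (forall i, measurable (A i)) ->
    P (\bigcap_(i in [set` J]) (X i @^-1` A i)) =
    (\prod_(i in J) P (X i @^-1` A i))%E.

Definition has_density (X : {RV P >-> R}) (f : R -> R) : Prop :=
  [/\ measurable_fun [set: R] f,
      forall x, 0 <= f x
    & forall A : set R, measurable A ->
        distribution P X A = (\int[lebesgue_measure]_(x in A) (f x)%:E)%E].

(* The sum over x of dirac x defines an extended-real valued point process:
   when G w is the zero polynomial, every infinite B has infinite mass. *)
Definition real_zeros_measure (G : T -> {poly R}) (w : T) (B : set R) : \bar R :=
  \esum_(x in [set x : R | (G w).[x] = 0]) \d_x B.

(* The identity determines rho only almost everywhere, whence the values in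
   \bar R: a version given by an explicit integral may be infinite on a null
   set. *)
Definition is_correlation_function (mu : T -> set R -> \bar R) (k : nat)
    (rho : k.-tuple (measurableTypeR R) -> \bar R) : Prop :=
  [/\ measurable_fun [set: k.-tuple (measurableTypeR R)] rho,
      forall x, (0 <= rho x)%E
    & forall B : 'I_k -> set R, (forall i, measurable (B i)) ->
        trivIset setT B ->
        (\int[P]_w \prod_(i < k) mu w (B i) =
         \int[lebesgue_tuple R k]_(x in [set x | forall i, B i (tnth x i)])
           rho x)%E].

End random_variables.

Arguments independent_RVs {d T R} P {I} X.
Arguments has_density {d T R} P X f.

Definition elem_sym (R : realType) (k : nat) (i : int) (x : k.-tuple R) : R :=
  \sum_(A : {set 'I_k} | #|A|%:Z == i) \prod_(j in A) tnth x j.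

Definition random_poly (R : realType) (T : Type) (n : nat)
    (xi : 'I_n.+1 -> T -> R) (w : T) : {poly R} :=
  \sum_(i < n.+1) xi i w *: 'X^i.

(* Main.v *)
Require Import Defs.
From HB Require Import structures.
From mathcomp Require Import all_boot all_order all_algebra.
From mathcomp Require Import all_classical all_reals all_analysis.
From mathcomp Require Import measurable_realfun.
From mathcomp Require Import polyrcf ring zify.

Set Implicit Arguments.
Unset Strict Implicit.
Unset Printing Implicit Defensive.

Import Order.TTheory GRing.Theory Num.Theory.
Import numFieldNormedType.Exports.

Local Open Scope classical_set_scope.
Local Open Scope ring_scope.

(** The real zeros can be extracted one at a time. For a fixed polynomial p, the
one-dimensional area formula says that the zeros of p + a_0, summed over and
integrated in a_0, have density |p'(x)| at x. If p + a_0 = (X - x) b, then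
p'(x) = b(x), and for fixed x the map sending the nonconstant coefficients of p
to those of the quotient b is a triangular shear, which preserves Lebesgue
measure. So the sum over the zeros x of a polynomial with coefficients a
becomes an integral over (x, b) with weight |b(x)|. A zero of the polynomial
that differs from x is a zero of b, so one can iterate: after k steps the
polynomial is prod_i (X - x_i) times a quotient with coefficients t, and the
weights multiply to prod_{i<j} |x_i - x_j| prod_i |t(x_i)|. The coefficients
of the product are those in the formula, by Vieta. *)

(** * Integration against a measure with a density *)

Section density_measure.
Local Open Scope ereal_scope.
Context d (T : measurableType d) (R : realType).
Variables (mu : {measure set T -> \bar R}) (f : T -> R).
Hypotheses (mf : measurable_fun setT f) (f0 : forall x, (0 <= f x)%R).

(** The two proofs are arguments of the definition so that the measure structure can be inferred
    from the term. *)
Definition density_measure of measurable_fun setT f & (forall x, (0 <= f x)%R) :=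
  fun A : set T => \int[mu]_(x in A) (f x)%:E.

Local Notation nu := (density_measure mf f0).

Let nu0 : nu set0 = 0.
Proof. by rewrite /density_measure integral_set0. Qed.

Let nu_ge0 A : 0 <= nu A.
Proof. by apply: integral_ge0 => x _; rewrite lee_fin. Qed.

Let nu_sigma_additive : semi_sigma_additive nu.
Proof.
move=> F mF tF mUF; rewrite /density_measure ge0_integral_bigcup//.
- by apply: is_cvg_ereal_nneg_natsum_cond => n _ _; apply: integral_ge0 => x _; rewrite lee_fin.
- exact/measurable_EFinP/measurable_funTS.
- by move=> x _; rewrite lee_fin.
Qed.

HB.instance Definition _ := isMeasure.Build _ _ _ nu
  nu0 nu_ge0 nu_sigma_additive.

Import HBNNSimple.

(** Monotone convergence along simple approximations of [g] reduces the formula to indicators, for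
    which it is the definition of [density_measure]. *)
Lemma ge0_integral_density (g : T -> \bar R) :
  measurable_fun setT g -> (forall x, 0 <= g x) ->
  \int[nu]_x g x = \int[mu]_x ((f x)%:E * g x).
Proof.
move=> mg g0; pose g_ := nnsfun_approx measurableT mg.
have g_cvg x : (g_ n x)%:E @[n --> \oo] --> g x by exact: cvg_nnsfun_approx.
have g_nd x : {homo (fun n => (g_ n x)%:E) : n m / (n <= m)%N >-> n <= m}.
  by move=> n m nm; rewrite lee_fin; exact/lefP/nd_nnsfun_approx.
have mg_ n : measurable_fun setT (fun x => (g_ n x)%:E).
  exact/measurable_EFinP.
transitivity (limn (fun n => \int[nu]_x (g_ n x)%:E)).
  rewrite -monotone_convergence//; last by move=> n x _; rewrite lee_fin.
  by apply: eq_integral => x _; apply/esym/cvg_lim.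
transitivity (limn (fun n => \int[mu]_x ((f x)%:E * (g_ n x)%:E))); last first.
  rewrite -monotone_convergence//.
  - by apply: eq_integral => x _; apply/cvg_lim => //; exact: cvgeZl.
  - by move=> n; apply: emeasurable_funM; exact/measurable_EFinP.
  - by move=> n x _; rewrite mule_ge0// lee_fin.
  - by move=> x _ n m nm; rewrite lee_wpmul2l ?lee_fin//; exact: g_nd.
congr (limn _); apply/funext => n.
under [LHS]eq_integral do rewrite fimfunE -fsumEFin//.
rewrite ge0_integral_fsum//; last 2 first.
- by move=> y; exact/measurable_EFinP/measurable_funM.
- by move=> y x _; rewrite nnfun_muleindic_ge0.
under [RHS]eq_integral => x _.
  rewrite fimfunE -fsumEFin// ge0_mule_fsumr; last first.
    by move=> y; rewrite EFinM nnfun_muleindic_ge0.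
  over.
rewrite ge0_integral_fsum//; last 2 first.
- move=> y; apply: emeasurable_funM; first exact/measurable_EFinP.
  exact/measurable_EFinP/measurable_funM.
- by move=> y x _; rewrite mule_ge0 ?lee_fin//; exact: nnfun_muleindic_ge0.
apply: eq_fsbigr => r; rewrite inE => -[x _ gxr].
have r0 : (0 <= r)%R by rewrite -gxr.
rewrite integralZl_indic_nnsfun// integral_indic// setIT.
under [RHS]eq_integral do rewrite EFinM muleCA.
rewrite ge0_integralZl_EFin//; last 2 first.
- by move=> y _; rewrite mule_ge0// lee_fin.
- by apply: emeasurable_funM; exact/measurable_EFinP.
by rewrite /= /density_measure integral_mkcond epatch_indic.
Qed.

End density_measure.

Section measurable_sections.
Context d1 d2 d3 (X : measurableType d1) (Y : measurableType d2)
  (Z : measurableType d3) (f : X -> Y -> Z).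
Hypothesis mf : measurable_fun setT (fun z : X * Y => f z.1 z.2).

Lemma measurable_fun_fixl x : measurable_fun setT (f x).
Proof. exact: (measurableT_comp mf (pair1_measurable x)). Qed.

Lemma measurable_fun_fixr y : measurable_fun setT (f ^~ y).
Proof. exact: (measurableT_comp mf (pair2_measurable y)). Qed.

End measurable_sections.

(** * Measurability of the ordered real zeros of a polynomial depending on a parameter *)

Lemma nat_roots_eq0 (R : numDomainType) (p : {poly R}) :
  (forall i : nat, root p i%:R) -> p = 0.
Proof.
move=> rp; apply: contrapT => /eqP p0.
pose s : seq R := [seq i%:R | i <- iota 0 (size p)].
have := @max_poly_roots _ p s p0.
rewrite size_map size_iota ltnn => H; suff : false by [].
apply: H; first by apply/allP => _ /mapP[i _ ->]; exact: rp.
by rewrite map_inj_uniq ?iota_uniq//; exact: mulrIn (oner_neq0 _).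
Qed.

(** [rootsR] is empty for the zero polynomial, whence the first conjunct. *)
Lemma mem_rootsR (R : rcfType) (p : {poly R}) x :
  (x \in rootsR p) = (p != 0) && root p x.
Proof.
have [->|p0] := eqVneq p 0; first by rewrite rootsR0.
by rewrite -roots_on_rootsR.
Qed.

Lemma sorted_rootsR (R : rcfType) (p : {poly R}) : sorted <%R (rootsR p).
Proof. exact: sorted_roots. Qed.

Lemma nth_rootsR_lt (R : rcfType) (p : {poly R}) i j :
  (i < j < size (rootsR p))%N -> (rootsR p)`_i < (rootsR p)`_j.
Proof.
move=> /andP[ij js]; apply: (sorted_ltn_nth lt_trans) => //.
- exact: sorted_rootsR.
- by rewrite inE (ltn_trans ij).
Qed.

Lemma nth_rootsR_ltn (R : rcfType) (p : {poly R}) i j :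
  (i < size (rootsR p))%N -> (rootsR p)`_i < (rootsR p)`_j -> (i < j)%N.
Proof.
move=> si rij; case: (ltngtP i j) => // [ji|ij]; last first.
  by rewrite ij ltxx in rij.
by have := lt_trans rij (@nth_rootsR_lt _ p j i _); rewrite ji si ltxx => /(_ isT).
Qed.

Section measurable_roots.
Context d (X : measurableType d) (R : realType) (q : X -> {poly R}).
Hypothesis mq : forall t, measurable_fun setT (fun x => (q x).[t]).

(** A polynomial with infinitely many zeros vanishes, so the countably many evaluations at natural
    numbers decide the event. *)
Lemma measurable_poly_eq0 : measurable [set x | q x = 0].
Proof.
rewrite (_ : mkset _ = \bigcap_i ((fun x => (q x).[i%:R]) @^-1` [set 0])).
  apply: bigcap_measurableType => i _.
  by rewrite -[X in measurable X]setTI; exact: mq.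
apply/seteqP; split=> [x /= qx i _|x /= qx]; first by rewrite /= qx horner0.
by apply: nat_roots_eq0 => i; apply/rootP/qx.
Qed.

(** By compactness, [[a, b]] contains a zero as soon as the values at its rational points come
    arbitrarily close to 0; the converse is continuity. Only countably many evaluations are
    involved. *)
Lemma measurable_root_itv a b : a < b ->
  measurable [set x | exists2 t, t \in `[a, b] & root (q x) t].
Proof.
move=> ab.
rewrite (_ : mkset _ = \bigcap_m \bigcup_(r : rat)
    [set x | (ratr r \in `[a, b]) && (`|(q x).[ratr r]| < m.+1%:R^-1)]).
  apply: bigcap_measurableType => m _; apply: bigcupT_measurable_rat => r.
  have [rab|rab] := boolP (ratr r \in `[a, b]); last first.
    by rewrite (_ : mkset _ = set0)//; apply/seteqP; split.
  rewrite -[X in measurable X]setTI.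
  apply: (@measurable_fun_ltr _ _ _ _ _ (cst _)) => //.
  exact: measurableT_comp.
apply/seteqP; split=> [x /= [t tab /eqP qt0] m _|x /= h].
  have [e e0 he] := @poly_cont R t (q x) m.+1%:R^-1 ltac:(by rewrite invr_gt0).
  (* This open interval is nonempty because [a < b]; a rational in it is close to [t] without
     leaving [[a, b]], even if [t] is an endpoint. *)
  have [r] : exists r, ratr r \in `]Num.max a (t - e), Num.min b (t + e)[%R.
    move: tab; rewrite in_itv/= => /andP[a_t tb]; apply: rat_in_itvoo.
    rewrite gt_max !lt_min ab/=; apply/and3P; split.
    - by rewrite (le_lt_trans a_t)// ltrDl.
    - by rewrite (lt_le_trans _ tb)// gtrDl oppr_lt0.
    - by rewrite (@lt_trans _ _ t)// ?ltrDl// gtrDl oppr_lt0.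
  rewrite in_itv/= gt_max lt_min => /andP[/andP[ar tr] /andP[rb rt]].
  exists r => //; rewrite in_itv/= (ltW ar) (ltW rb)/=.
  have := he (ratr r); rewrite qt0 subr0; apply.
  by rewrite ltr_norml ltrBrDr addrC tr ltrBlDl rt.
(* The minimum of the absolute value is attained; if positive, it would exceed some 1/(m+1), against
   [h]. *)
have [|t tab tmin] := @EVT_min R (fun t => `|(q x).[t]|) a b (ltW ab).
  apply: continuous_subspaceT => t.
  by apply: continuous_comp; [exact: continuous_horner|exact: norm_continuous].
exists t => //; rewrite rootE -normr_eq0 eq_le normr_ge0 andbT leNgt.
apply/negP => /ltr_add_invr[m]; rewrite add0r => mt.
have [r _ /andP[rab rm]] := h m I.
by have := lt_trans rm (lt_le_trans mt (tmin _ rab)); rewrite ltxx.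
Qed.

(** Looking in [rootsR] instead of testing [root] leaves out the zero polynomial. *)
Let hasroot x a b := has (fun t => a <= t <= b) (rootsR (q x)).

Let measurable_hasroot a b : a < b -> measurable [set x | hasroot x a b].
Proof.
move=> ab; rewrite (_ : mkset _ =
    [set x | exists2 t, t \in `[a, b] & root (q x) t] `\` [set x | q x = 0]).
  by apply: measurableD; [exact: measurable_root_itv|exact: measurable_poly_eq0].
apply/seteqP; split=> x /=.
  move=> /hasP[t]; rewrite mem_rootsR => /andP[/eqP qx rt] tab.
  by split=> //; exists t.
move=> [[t tab rt] /eqP qx]; apply/hasP; exists t => //.
by rewrite mem_rootsR qx.
Qed.

(* Quantifying over rational intervals makes the event "the j-th zero is below s"
   a countable combination of events "there is a zero in [r, r']". *)
Let nth_rootsR_ltP j x s :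
  (j < size (rootsR (q x)))%N && ((rootsR (q x))`_j < s) <->
  exists r r' : rat, [/\ ratr r < ratr r' :> R, ratr r' < s,
    (j == 0)%N || (j.-1 < size (rootsR (q x)))%N &&
                  ((rootsR (q x))`_j.-1 < ratr r)
    & hasroot x (ratr r) (ratr r')].
Proof.
split=> [/andP[js rjs]|[r [r' [rr' r's jr /hasP[t]]]]].
  (* [l] is a barrier below the zero of rank [j]: the preceding zero or, for [j = 0], an arbitrary
     lower point. *)
  pose l := if j is i.+1 then (rootsR (q x))`_i else (rootsR (q x))`_0 - 1.
  have lj : l < (rootsR (q x))`_j.
    rewrite /l; case: j js {rjs l} => [|j] js; first by rewrite gtrDl oppr_lt0.
    by apply: nth_rootsR_lt; rewrite ltnSn.
  have [r'] := rat_in_itvoo rjs; rewrite in_itv/= => /andP[rjr' r's].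
  have [r] := rat_in_itvoo lj; rewrite in_itv/= => /andP[lr rrj].
  exists r, r'; split => //; first exact: lt_trans rrj rjr'.
    by case: j js @l lj lr {rjs rjr' rrj} => [|j] //= js _ lr; rewrite lr ltnW.
  by apply/hasP; exists (rootsR (q x))`_j; [exact: mem_nth|rewrite !ltW].
move=> /(nthP 0)[i isz <-] /andP[ri ir'].
(* A zero above the one of rank [j - 1] has rank at least [j]. *)
have ji : (j <= i)%N.
  case: j jr => [//|j] /=; move=> /andP[jsz jr].
  by apply: (@nth_rootsR_ltn _ (q x)) => //; exact: lt_le_trans jr ri.
rewrite (leq_ltn_trans ji isz)/= (le_lt_trans _ r's)// (le_trans _ ir')//.
move: ji; rewrite leq_eqVlt => /predU1P[->//|ji].
by rewrite ltW// nth_rootsR_lt// ji.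
Qed.

Lemma measurable_nth_rootsR_lt j s : measurable
  [set x | (j < size (rootsR (q x)))%N && ((rootsR (q x))`_j < s)].
Proof.
elim: j s => [|j IHj] s.
  rewrite (_ : mkset _ = \bigcup_(r : rat) \bigcup_(r' : rat)
      [set x | [&& ratr r < ratr r' :> R, ratr r' < s
                 & hasroot x (ratr r) (ratr r')]]).
    apply: bigcupT_measurable_rat => r; apply: bigcupT_measurable_rat => r'.
    have [rr'|] /= := ltP (ratr r : R) (ratr r'); last by rewrite set_false.
    have [r's|] /= := ltP (ratr r') s; last by rewrite set_false.
    exact: measurable_hasroot.
  apply/seteqP; split=> x /=.
    by move=> /nth_rootsR_ltP[r [r' [*]]]; exists r => //; exists r' => //; apply/and3P.
  by move=> [r _ [r' _ /and3P[*]]]; apply/nth_rootsR_ltP; exists r, r'.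
rewrite (_ : mkset _ = \bigcup_(r : rat) \bigcup_(r' : rat)
    ([set x | (j < size (rootsR (q x)))%N && ((rootsR (q x))`_j < ratr r)] `&`
    [set x | [&& ratr r < ratr r' :> R, ratr r' < s
               & hasroot x (ratr r) (ratr r')]])).
  apply: bigcupT_measurable_rat => r; apply: bigcupT_measurable_rat => r'.
  apply: measurableI => //.
  have [rr'|] /= := ltP (ratr r : R) (ratr r'); last by rewrite set_false.
  have [r's|] /= := ltP (ratr r') s; last by rewrite set_false.
  exact: measurable_hasroot.
apply/seteqP; split=> x /=.
  move=> /nth_rootsR_ltP[r [r' [*]]]; exists r => //; exists r' => //.
  by split=> //; apply/and3P.
by move=> [r _ [r' _ [? /and3P[*]]]]; apply/nth_rootsR_ltP; exists r, r'.
Qed.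

Lemma measurable_size_rootsR j :
  measurable_fun setT (fun x => (j < size (rootsR (q x)))%N).
Proof.
apply: (measurable_fun_bool true); rewrite setTI.
rewrite (_ : _ @^-1` _ = \bigcup_(m : nat)
    [set x | (j < size (rootsR (q x)))%N && ((rootsR (q x))`_j < m%:R)]).
  by apply: bigcup_measurable => m _; exact: measurable_nth_rootsR_lt.
apply/seteqP; split=> x /=; last by move=> [m _ /andP[]].
move=> js; exists (Num.truncn (rootsR (q x))`_j).+1 => //=.
by rewrite js/= truncnS_gt.
Qed.

Lemma measurable_nth_rootsR j :
  measurable_fun setT (fun x => (rootsR (q x))`_j).
Proof.
apply: (measurability _ (RGenInftyO.measurableE R)) => //.
move=> _ [_ [s ->] <-]; rewrite setTI.
(* Where there is no zero of rank [j], the access to the list returns the default 0; the second set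
   accounts for this. *)
rewrite (_ : _ @^-1` _ =
    [set x | (j < size (rootsR (q x)))%N && ((rootsR (q x))`_j < s)] `|`
    ((fun x => (j < size (rootsR (q x)))%N) @^-1` [set false] `&`
     [set x | 0 < s])).
  apply: measurableU; first exact: measurable_nth_rootsR_lt.
  apply: measurableI; last by case: (0 < s); rewrite ?set_true ?set_false.
  rewrite -[X in measurable X]setTI; exact: measurable_size_rootsR.
apply/seteqP; split=> x /=; rewrite in_itv/=.
  have [js rs|js] := ltnP j; first by left.
  by rewrite nth_default//; right.
by move=> [/andP[]//|[/negbT]]; rewrite -leqNgt => js s0; rewrite nth_default.
Qed.

End measurable_roots.

(** * Sums over the real zeros *)

Definition root_sum (R : realType) (p : {poly R}) (h : R -> \bar R) : \bar R :=
  (\sum_(x <- rootsR p) h x)%E.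

Section root_sum.
Context (R : realType).
Implicit Types (p : {poly R}) (h : R -> \bar R).
Local Open Scope ereal_scope.

Lemma root_sum_ge0 p h : (forall x, 0 <= h x) -> 0 <= root_sum p h.
Proof. by move=> h0; apply: sume_ge0. Qed.

Lemma size_rootsR p : (size (rootsR p) <= size p)%N.
Proof.
have [->|p0] := eqVneq p 0%R; first by rewrite rootsR0.
apply/ltnW/max_poly_roots => //; last exact: uniq_roots.
by apply/allP => x; rewrite mem_rootsR => /andP[].
Qed.

(** A number [M] of terms that does not vary with [p] lets measurability and integration be treated
    term by term. *)
Lemma root_sum_nth p h M : (size p <= M)%N ->
  root_sum p h =
  \sum_(j < M) if (j < size (rootsR p))%N then h (rootsR p)`_j else 0.
Proof.
move=> pM; rewrite /root_sum (big_nth 0%R) big_mkord.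
have sM := leq_trans (size_rootsR p) pM.
by rewrite (big_ord_widen _ (fun j => h (rootsR p)`_j) sM) big_mkcond.
Qed.

Lemma measurable_root_sum d (X : measurableType d) (q : X -> {poly R}) M
    (h : X -> R -> \bar R) :
  (forall t, measurable_fun setT (fun x => (q x).[t])%R) ->
  (forall x, (size (q x) <= M)%N) ->
  measurable_fun setT (fun z : X * R => h z.1 z.2) ->
  measurable_fun setT (fun x => root_sum (q x) (h x)).
Proof.
move=> mq qM mh; under eq_fun do rewrite (root_sum_nth _ (qM _)).
apply: emeasurable_sum => j; apply: measurable_fun_ifT => //.
  exact: measurable_size_rootsR.
apply: (measurableT_comp (f := fun z : X * R => h z.1 z.2)
  (g := fun x => (x, (rootsR (q x))`_j)) mh).
apply: measurable_fun_pair => //.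
exact: measurable_nth_rootsR.
Qed.

End root_sum.

(** * The one-dimensional area formula for polynomials *)

Section area_formula.
Context (R : realType).
Implicit Types (p : {poly R}) (a b : R).
Local Notation mu := (@lebesgue_measure R).

Lemma measurable_horner p : measurable_fun setT (horner p).
Proof. by apply: continuous_measurable_fun => x; exact: continuous_horner. Qed.

Lemma noroot_neq0 p a b : a < b -> {in `]a, b[, forall x, ~~ root p x} -> p != 0.
Proof.
move=> ab dp; have := dp _ (mid_in_itvoo ab); by apply: contraNneq => ->; exact: root0.
Qed.

(** Without critical points inside, [p] is injective on [[a, b]], so [p + y] has at most one zero
    there and the sum is 0 or 1. *)
Lemma root_sum_itv p a b y : a < b -> {in `]a, b[, forall x, ~~ root p^`() x} ->
  root_sum (p + y%:P) (fun x => (\1_(`]a, b] : set R) x)%:E) =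
  (\1_[set y : R | exists2 x, x \in `]a, b] & p.[x] = - y] y)%:E.
Proof.
move=> ab dp; have py0 : p + y%:P != 0.
  apply: contraNneq (noroot_neq0 ab dp) => /(congr1 (@deriv _)).
  by rewrite derivD derivC addr0 deriv0 => ->.
have mem_py x : (x \in rootsR (p + y%:P)) = (p.[x] == - y).
  by rewrite mem_rootsR py0 rootE hornerD hornerC addr_eq0.
have subcc x : x \in `]a, b] -> x \in `[a, b].
  by rewrite !in_itv/= => /andP[/ltW -> ->].
rewrite indicE; have [/set_mem[x xab px]|] := boolP (y \in _).
  rewrite /root_sum (bigD1_seq x)/= ?mem_py ?px ?eqxx ?uniq_roots//.
  rewrite indicE mem_set//= big1_seq ?adde0// => z /andP[zx].
  rewrite mem_py => /eqP pz; rewrite indicE memNset//= => zab.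
  move/eqP: zx; apply; apply: (horner_inj ab dp); rewrite ?subcc//.
  by rewrite px.
move=> /negP h; rewrite /root_sum big1_seq// => x /andP[_].
rewrite mem_py => /eqP px; rewrite indicE memNset//= => xab; apply: h.
by rewrite inE; exists x.
Qed.

Lemma image_increasing_itv p a b z : a < b ->
  {in `]a, b[, forall x, 0 < p^`().[x]} ->
  (exists2 x, x \in `]a, b] & p.[x] = z) <-> z \in `]p.[a], p.[b]].
Proof.
move=> ab dp; split=> [[x xab <-]|].
  rewrite in_itv/=; apply/andP; split; first exact: (derpr dp).
  by apply: (derplW dp); move: xab; rewrite !in_itv/= => /andP[/ltW -> ->].
rewrite in_itv/= => /andP[az zb].
have [|x] := @poly_ivt _ (p - z%:P) a b (ltW ab).
  by rewrite !hornerE subr_le0 subr_ge0 zb ltW.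
rewrite rootE !hornerE subr_eq0 => xab /eqP px; exists x => //.
move: xab; rewrite !in_itv/= => /andP[+ ->]; rewrite andbT le_eqVlt.
by move=> /predU1P[ax|//]; rewrite -px -ax ltxx in az.
Qed.

Lemma integral_deriv_itv p a b : a < b ->
  {in `]a, b[, forall x, 0 < p^`().[x]} ->
  (\int[mu]_(x in `]a, b]) `|p^`().[x]|%:E = (p.[b] - p.[a])%:E)%E.
Proof.
move=> ab dp.
(* The sign of the derivative is known in the open interval only. The endpoints, a null set, are
   dropped to remove the absolute value and restored for the fundamental theorem of calculus. *)
rewrite -(@integral_itv_bndo_bndc _ (BRight a)); last first.
  by apply/measurable_EFinP/measurable_funTS; apply: measurableT_comp => //; exact: measurable_horner.
transitivity (\int[mu]_(x in `]a, b[) (p^`().[x])%:E)%E.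
  apply: eq_integral => x; rewrite inE => xab; congr EFin; exact: gtr0_norm (dp _ xab).
rewrite integral_itv_obnd_cbnd; last first.
  by apply/measurable_EFinP/measurable_funTS; exact: measurable_horner.
rewrite integral_itv_bndo_bndc; last first.
  by apply/measurable_EFinP/measurable_funTS; exact: measurable_horner.
rewrite (@continuous_FTC2 _ _ (horner p))//.
- by apply: continuous_subspaceT => x; exact: continuous_horner.
- split => [x _| |].
  + exact: derivable_horner.
  + by apply: cvg_at_right_filter; exact: continuous_horner.
  + by apply: cvg_at_left_filter; exact: continuous_horner.
- by move=> x _; rewrite -derivE.
Qed.

(** The derivative keeps its sign, so [p] is monotone and both sides equal |p(b) - p(a)|; the
    decreasing case goes through [- p]. *)
Lemma area_formula_monotone p a b : a < b -> {in `]a, b[, forall x, ~~ root p^`() x} ->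
  (\int[mu]_y root_sum (p + y%:P) (fun x => (\1_(`]a, b] : set R) x)%:E) =
   \int[mu]_(x in `]a, b]) `|p^`().[x]|%:E)%E.
Proof.
move=> ab dp; under eq_integral do rewrite root_sum_itv//.
have [m mab] : exists m, m \in `]a, b[ by eexists; exact: (mid_in_itvoo ab).
have [dp0|dp0] : {in `]a, b[, forall x, 0 < p^`().[x]} \/
                 {in `]a, b[, forall x, 0 < (- p)^`().[x]}.
  have sg x : x \in `]a, b[ ->  Num.sg p^`().[x] = Num.sg p^`().[m].
    by move=> xab; apply: (polyrN0_itv dp).
  have := dp _ mab; rewrite rootE.
  have [dm|dm|//] := ltgtP p^`().[m] 0 => _; [right|left] => x /sg.
    by rewrite derivN hornerN oppr_gt0 (ltr0_sg dm) => /eqP; rewrite sgr_cp0.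
  by rewrite (gtr0_sg dm) => /eqP; rewrite sgr_cp0.
- rewrite (_ : mkset _ = `[- p.[b], - p.[a][%classic).
    rewrite integral_indic// setIT integral_deriv_itv// [LHS]lebesgue_measure_itv/=.
    rewrite lte_fin ltrN2 (derpr dp0) ?in_itv/= ?ab ?lexx//.
    by rewrite -EFinB opprK addrC.
  apply/seteqP; split=> y /=.
    move=> /(image_increasing_itv _ ab dp0).
    by rewrite !in_itv/= ltrNr lerNl => /andP[-> ->].
  move=> yab; apply/(image_increasing_itv _ ab dp0); move: yab.
  by rewrite !in_itv/= ltrNr lerNl => /andP[-> ->].
- under [RHS]eq_integral do rewrite -normrN -hornerN -derivN.
  rewrite (_ : mkset _ = `]- p.[a], - p.[b]]%classic).
    rewrite integral_indic// setIT integral_deriv_itv// [LHS]lebesgue_measure_itv/=.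
    rewrite lte_fin -!hornerN (derpr dp0) ?in_itv/= ?ab ?lexx//.
  apply/seteqP; split=> y /=.
    move=> [x xab pxy].
    have : exists2 x, x \in `]a, b] & (- p).[x] = y.
      by exists x => //; rewrite hornerN pxy opprK.
    by move=> /(image_increasing_itv _ ab dp0); rewrite !hornerN.
  rewrite -!hornerN => /(image_increasing_itv _ ab dp0)[x xab pxy].
  by exists x => //; rewrite -pxy hornerN opprK.
Qed.

End area_formula.

Section area_formula_measure.
Context (R : realType) (p : {poly R}).
Local Open Scope ereal_scope.
Local Notation mu := (@lebesgue_measure R).
Local Notation RT := (measurableTypeR R).

Let q (y : RT) : {poly R} := (p + y%:P)%R.
Let M := maxn (size p) 1.

Let qM y : (size (q y) <= M)%N.
Proof.
rewrite (leq_trans (size_polyD _ _))// geq_max leq_maxl/=.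
by rewrite (leq_trans (size_polyC_leq1 _))// leq_maxr.
Qed.

Let mq t : measurable_fun setT (fun y : RT => (q y).[t])%R.
Proof.
under eq_fun do rewrite hornerD hornerC.
exact: measurable_funD.
Qed.

Let has_nth j : RT -> R := fun y => if (j < size (rootsR (q y)))%N then 1%R else 0%R.

Let mhas_nth j : measurable_fun setT (has_nth j).
Proof. by apply: measurable_fun_ifT => //; exact: measurable_size_rootsR. Qed.

Let has_nth_ge0 j y : (0 <= has_nth j y)%R.
Proof. by rewrite /has_nth; case: ifP. Qed.

Let nth_root j : RT -> RT := fun y => (rootsR (q y))`_j.

Let mnth j : measurable_fun setT (nth_root j).
Proof. exact: measurable_nth_rootsR. Qed.

(* The sum over the zeros is split by rank because each rank gives a pushforward
   measure, which is compared with |p'| dx on the intervals ]a, b]. *)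
Let nth_law : {measure set RT -> \bar R}^nat.
Proof.
move=> j; unshelve refine [the measure RT R of pushforward
  (density_measure mu (mhas_nth j) (@has_nth_ge0 j)) (nth_root j)].
exact: mnth.
Defined.

Let ge0_integral_nth_law (g : RT -> \bar R) : measurable_fun setT g ->
  (forall x, 0 <= g x) ->
  \int[msum nth_law M]_x g x = \int[mu]_y root_sum (q y) g.
Proof.
move=> mg g0; rewrite ge0_integral_measure_sum//.
have mgn j : measurable_fun [set: RT] (g \o nth_root j).
  by apply: measurableT_comp => //; exact: mnth.
under [RHS]eq_integral do rewrite (root_sum_nth _ (qM _)).
rewrite ge0_integral_sum//; last 2 first.
- move=> j; apply: measurable_fun_ifT => //; first exact: measurable_size_rootsR.
  exact: mgn.
- by move=> j y _; case: ifP.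
apply: eq_bigr => j _; rewrite (ge0_integral_pushforward (mnth j))//.
rewrite preimage_setT ge0_integral_density//; last by move=> x; exact: g0.
by apply: eq_integral => y _; rewrite /has_nth; case: ifP; rewrite ?mul1e ?mul0e.
Qed.

Let mdp : measurable_fun setT (fun x : RT => `|p^`().[x]|)%R.
Proof. by apply: measurableT_comp => //; exact: measurable_horner. Qed.

Let dp_ge0 x : (0 <= `|p^`().[x]|)%R. Proof. by []. Qed.

Let speed : {measure set RT -> \bar R} :=
  [the measure RT R of density_measure mu mdp dp_ge0].

(** Cutting at the finitely many critical points reduces the claim to intervals without one inside.
    The induction is on a list containing the critical points of the interval. *)
Let nth_lawE a b : (a < b)%R ->
  msum nth_law M `]a, b]%classic = speed `]a, b]%classic.
Proof.
move=> ab.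
have eE c e : msum nth_law M `]c, e]%classic =
    \int[mu]_y root_sum (q y) (fun x => (\1_(`]c, e] : set R) x)%:E).
  rewrite -ge0_integral_nth_law//; first by rewrite integral_indic// setIT.
  exact/measurable_EFinP.
(* A zero derivative is treated apart, since its [rootsR] is empty instead of listing all critical
   points. Then [p + y] is constant and both sides are 0. *)
have [dp0|dp0] := eqVneq p^`()%R 0%R.
  rewrite eE /speed /= /density_measure.
  under [RHS]eq_integral do rewrite dp0 horner0 normr0.
  rewrite integral0 integral0_eq// => y _; rewrite /root_sum /q.
  rewrite (_ : p = (p`_0)%:P); first by rewrite -polyCD rootsRC big_nil.
  apply/polyP => -[|i]; rewrite coefC//=; apply/eqP.
  by rewrite -[_ == _](mulrn_eq0 _ i.+1) -coef_deriv dp0 coef0.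
have : forall x, x \in `]a, b[ -> root p^`() x -> x \in rootsR p^`().
  by move=> x _ rx; rewrite mem_rootsR dp0.
elim: (rootsR p^`()) a b ab => [|c s IHs] a b ab sub.
  by rewrite eE area_formula_monotone// => x xab; apply/negP => /(sub _ xab).
(* A listed point outside the interval is dropped; one inside becomes the common endpoint of two
   subintervals and leaves both interiors. *)
have [cab|cab] := boolP (c \in `]a, b[); last first.
  apply: IHs => // x xab rx; move: (sub x xab rx); rewrite inE => /predU1P[xc|//].
  by rewrite -xc xab in cab.
move: cab; rewrite in_itv/= => /andP[ac cb].
have -> : `]a, b]%classic = `]a, c] `|` `]c, b] :> set RT.
  by apply: itv_bndbnd_setU; rewrite bnd_simp ltW.
have dis : [disjoint `]a, c]%classic & `]c, b] : set R].
  by apply/disj_setPLR => x/=; rewrite !in_itv/= => /andP[_ xc]; rewrite ltNge xc.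
have measureUE (m : {measure set RT -> \bar R}) :
    m (`]a, c]%classic `|` `]c, b]%classic) = m `]a, c]%classic + m `]c, b]%classic.
  by rewrite measureU//; exact/disj_set2P.
rewrite !measureUE; congr (_ + _); apply: IHs => // x.
- rewrite in_itv/= => /andP[x1 x2] rx.
  have := sub x; rewrite in_itv/= x1 (lt_trans x2 cb) rx => /(_ isT isT).
  by rewrite inE => /predU1P[xc|//]; rewrite xc ltxx in x2.
- rewrite in_itv/= => /andP[x1 x2] rx.
  have := sub x; rewrite in_itv/= (lt_trans ac x1) x2 rx => /(_ isT isT).
  by rewrite inE => /predU1P[xc|//]; rewrite xc ltxx in x1.
Qed.

Let speed_fin a b : speed `]a, b]%classic < +oo.
Proof.
have /integrableP[_] : mu.-integrable `]a, b]%classic (fun x => `|p^`().[x]|%:E).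
  apply: (@integrableS _ _ _ mu `[a, b]%classic) => //.
    exact: subset_itv_oc_cc.
  apply: continuous_compact_integrable; first exact: segment_compact.
  apply: continuous_subspaceT => x.
  by apply: continuous_comp; [exact: continuous_horner|exact: norm_continuous].
by under eq_integral do rewrite /= normr_id.
Qed.

(** The two sides integrate [g] against the sum of the [nth_law] and against [speed]. These measures
    agree on the intervals []a, b]], a generating class closed under intersection, and are finite
    there, so they coincide. *)
Lemma area_formula (g : RT -> \bar R) : measurable_fun setT g ->
  (forall x, 0 <= g x) ->
  \int[mu]_y root_sum (p + y%:P)%R g = \int[mu]_x (`|p^`().[x]|%:E * g x).
Proof.
move=> mg g0; rewrite -ge0_integral_nth_law// -(ge0_integral_density mu mdp dp_ge0)//.
apply: eq_measure_integral => A mA _.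
pose G k : set RT := `](- k%:R)%R, k%:R]%classic.
apply: (@measure_unique _ R RT (@ocitv R) G _ _ _ _ (msum nth_law M) speed) => //.
- exact: ocitvI.
- by move=> k; exact: is_ocitv.
- apply/seteqP; split=> // x _; exists (Num.truncn `|x|).+1 => //=.
  have := truncnS_gt `|x|; rewrite ltr_norml /G => /andP[xl /ltW xr].
  by rewrite /= in_itv/= xl xr.
- by move=> X /ocitvP[->|[[a b] /= ab ->]]; rewrite ?measure0// nth_lawE.
(* At index 0 the interval is empty and [nth_lawE] does not apply. *)
- move=> [|k]; first by rewrite /G set_itv_ge ?measure0// oppr0 bnd_simp ltxx.
  rewrite -[ltLHS]/(msum nth_law M (G k.+1)).
  have -> : msum nth_law M (G k.+1) = speed (G k.+1).
    by apply: nth_lawE; rewrite (@lt_trans _ _ 0%R)// oppr_lt0.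
  exact: speed_fin.
Qed.

End area_formula_measure.

(** * Lebesgue measure on tuples: iterated integrals and translations *)

Section lebesgue_tuple.
Context (R : realType).
Local Open Scope ereal_scope.
Local Notation RT := (measurableTypeR R).
Local Notation mu := (@lebesgue_measure R).

Lemma integral_lebesgue_tuple0 (h : 0.-tuple RT -> \bar R) :
  measurable_fun setT h -> \int[lebesgue_tuple R 0]_t h t = h [tuple].
Proof. by move=> mh; rewrite integral_dirac// diracT mul1e. Qed.

Section cons.
Variables (m : nat) (h : m.+1.-tuple RT -> \bar R).
Hypotheses (mh : measurable_fun setT h) (h0 : forall t, 0 <= h t).

Let mhc : measurable_fun setT (fun z : RT * m.-tuple RT => h (tcons z)).
Proof. by apply: measurableT_comp => //; exact: measurable_tcons. Qed.

Let hc : \int[lebesgue_tuple R m.+1]_t h t =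
  \int[mu \x lebesgue_tuple R m]_z h (tcons z).
Proof.
have := @ge0_integral_pushforward _ _ _ _ R _ (@measurable_tcons _ RT m)
  [the measure _ _ of mu \x lebesgue_tuple R m] setT h measurableT mh (fun t _ => h0 t).
by rewrite preimage_setT.
Qed.

Lemma integral_lebesgue_tupleS : \int[lebesgue_tuple R m.+1]_t h t =
  \int[mu]_x \int[lebesgue_tuple R m]_t h (tcons (x, t)).
Proof. by rewrite hc fubini_tonelli1. Qed.

Lemma integral_lebesgue_tupleS_swap : \int[lebesgue_tuple R m.+1]_t h t =
  \int[lebesgue_tuple R m]_t \int[mu]_x h (tcons (x, t)).
Proof. by rewrite hc fubini_tonelli2. Qed.

End cons.

(** This is the area formula for [c - X]: the polynomial [c - X + y] has the single zero [y + c],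
    and its derivative is -1. *)
Lemma integral_lebesgue_measureD (c : R) (g : RT -> \bar R) :
  measurable_fun setT g -> (forall x, 0 <= g x) ->
  \int[mu]_y g (y + c)%R = \int[mu]_y g y.
Proof.
move=> mg g0; have := area_formula (c%:P - 'X) mg g0.
under eq_integral => y _.
  have -> : root_sum (c%:P - 'X + y%:P)%R g = g (y + c)%R.
    rewrite /root_sum (_ : rootsR _ = [:: (y + c)%R]) ?big_seq1//.
    apply: (irr_sorted_eq lt_trans) => //; first exact: sorted_rootsR.
    move=> z; rewrite mem_rootsR inE rootE !hornerE.
    have -> : (c - z + y = y + c - z)%R by ring.
    rewrite subr_eq0 [RHS]eq_sym andb_idl// => _; apply/eqP => /(congr1 (horner^~ (y + c + 1)%R)).
    rewrite !hornerE; have -> : (c - (y + c + 1) + y = - 1)%R by ring.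
    by move/eqP; rewrite oppr_eq0 oner_eq0.
  over.
move=> ->; apply: eq_integral => x _.
by rewrite derivB derivC derivX sub0r hornerN hornerC normrN normr1 mul1e.
Qed.

End lebesgue_tuple.

(** * Synthetic division as a measure-preserving shear *)

Section synthetic_division.
Context (R : realType).
Local Notation RT := (measurableTypeR R).

(* Horner's scheme: the quotient by 'X - x of any c + 'X * Poly t vanishing at x,
   the constant c being irrelevant. *)
Definition synthetic_quotient m (x : R) (t : m.-tuple RT) : m.-tuple RT :=
  [tuple (Poly (drop i t : seq R)).[x] | i < m].

(** The triangular form of the map: the first entry is translated by a quantity that depends only on
    the others. *)
Lemma synthetic_quotient_cons m x (a : R) (t : m.-tuple RT) :
  synthetic_quotient x (tcons (a, t)) =
  tcons ((Poly (t : seq R)).[x] * x + a, synthetic_quotient x t).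
Proof.
apply: eq_from_tnth => i; rewrite tnth_mktuple.
case: (unliftP ord0 i) => [j ->|->].
  by rewrite /tcons tnthS tnth_mktuple.
by rewrite /= cons_poly_def !hornerE.
Qed.

(** The left side is [c + 'X * Poly t] for the constant [c] that makes [x] a zero. *)
Lemma synthetic_divisionP m (x : R) (t : m.-tuple RT) :
  Poly (t : seq R) * 'X - ((Poly (t : seq R)).[x] * x)%:P =
  ('X - x%:P) * Poly (synthetic_quotient x t : seq R).
Proof.
elim: m t => [|m IHm] t.
  have Poly0 (u : 0.-tuple RT) : Poly (u : seq R) = 0 by rewrite tuple0.
  by rewrite !Poly0 horner0 !mul0r subr0 mulr0.
rewrite (tuple_eta t) -[[tuple of _]]/(tcons (thead t, [tuple of behead t])).
move: (thead t) [tuple of behead t] => a s; rewrite synthetic_quotient_cons /=.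
have := IHm s; rewrite !cons_poly_def !hornerE.
set P := Poly s; set Q := Poly (synthetic_quotient x s) => PQ.
rewrite mulrDr mulrA -PQ !polyCD !polyCM.
ring.
Qed.

Lemma horner_Poly_nth N (s : seq R) x : (size s <= N)%N ->
  (Poly s).[x] = \sum_(j < N) s`_j * x ^+ j.
Proof.
move=> sN; rewrite (@horner_coef_wide _ N); last exact: leq_trans (size_Poly _) sN.
by apply: eq_bigr => j _; rewrite coef_Poly.
Qed.

Lemma measurable_nth_tuple m k :
  measurable_fun setT (fun t : m.-tuple RT => nth (0 : R) t k : R).
Proof.
have [km|mk] := ltnP k m.
  apply: (eq_measurable_fun (fun t => tnth t (Ordinal km))) => [t _|].
    by rewrite (tnth_nth (0 : R)).
  exact: measurable_tnth.
apply: (eq_measurable_fun (fun=> (0 : R))) => [t _|]; last exact: measurable_cst.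
by rewrite /= nth_default ?size_tuple.
Qed.

Lemma measurable_horner_drop m i : measurable_fun setT
  (fun z : RT * m.-tuple RT => (Poly (drop i (z.2 : seq R))).[z.1]).
Proof.
under eq_fun => z.
  rewrite (@horner_Poly_nth m); last by rewrite size_drop size_tuple leq_subr.
  under eq_bigr do rewrite nth_drop.
  over.
apply: measurable_sum => j. apply: measurable_funM.
  apply: (measurableT_comp (f := fun t : m.-tuple RT => nth (0 : R) t (i + j))
    (g := snd)) => //.
  exact: measurable_nth_tuple.
by apply: measurable_funX; exact: measurable_fst.
Qed.

Lemma measurable_synthetic_quotient m :
  measurable_fun setT (fun z : RT * m.-tuple RT => synthetic_quotient z.1 z.2).
Proof.
apply/measurable_fun_tnthP => i.
apply: (eq_measurable_fun (fun z : RT * m.-tuple RT => (Poly (drop i (z.2 : seq R))).[z.1])).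
  by move=> z _; rewrite /= tnth_mktuple.
exact: measurable_horner_drop.
Qed.

Local Open Scope ereal_scope.
Local Notation mu := (@lebesgue_measure R).

Lemma integral_synthetic_quotient m (x : R) (h : m.-tuple RT -> \bar R) :
  measurable_fun setT h -> (forall t, 0 <= h t) ->
  \int[lebesgue_tuple R m]_t h (synthetic_quotient x t) =
  \int[lebesgue_tuple R m]_t h t.
Proof.
elim: m h => [|m IHm] h mh h0.
  by apply: eq_integral => t _; rewrite [t]tuple0 [synthetic_quotient _ _]tuple0.
have msq k : measurable_fun setT (fun t : k.-tuple RT => synthetic_quotient x t).
  exact: (@measurable_fun_fixl _ _ _ RT _ _ _ (@measurable_synthetic_quotient k)).
have mhp : measurable_fun setT (fun z : RT * m.-tuple RT => h (tcons (z.1, z.2))).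
  apply: (measurableT_comp mh); under eq_fun do rewrite -surjective_pairing.
  exact: measurable_tcons.
have mhc t : measurable_fun setT (fun a : RT => h (tcons (a, t))).
  exact: (measurable_fun_fixr (f := fun a t => h (tcons (a, t)))).
have mhc' : measurable_fun setT (fun z : RT * m.-tuple RT =>
    h (tcons (z.1, synthetic_quotient x z.2))).
  apply: (measurableT_comp mh); apply: (measurableT_comp (@measurable_tcons _ RT m)).
  apply: measurable_fun_pair => //.
  exact: (measurableT_comp (msq m) measurable_snd).
(* The first entry is integrated innermost: for fixed [t] its shift is a constant, which translation
   invariance removes. *)
rewrite integral_lebesgue_tupleS_swap//; last exact: (measurableT_comp mh (msq _)).
under eq_integral => t _.
  under eq_integral do rewrite synthetic_quotient_cons addrC.
  rewrite (integral_lebesgue_measureD _ (mhc _)); last by [].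
  over.
(* The order is reversed so that the first entry is fixed when the induction hypothesis treats the
   others. *)
rewrite -(fubini_tonelli _ mhc')//= integral_lebesgue_tupleS//.
apply: eq_integral => a _; apply: (IHm (fun t => h (tcons (a, t)))) => //.
exact: (measurable_fun_fixl (f := fun a t => h (tcons (a, t)))).
Qed.

End synthetic_division.

(** * Extraction of one zero *)

Section deflation.
Context (R : realType).
Local Open Scope ereal_scope.
Local Notation RT := (measurableTypeR R).
Local Notation mu := (@lebesgue_measure R).

Lemma measurable_horner_Poly m : measurable_fun setT
  (fun z : RT * m.-tuple RT => (Poly (z.2 : seq R)).[z.1]%R).
Proof.
have := @measurable_horner_drop R m 0; apply: eq_measurable_fun => z _.
by rewrite drop0.
Qed.

(** Differentiating [(X - x) Q] at [x] leaves [Q(x)]: the weight in the area formula depends only on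
    [x] and the quotient. *)
Lemma deriv_synthetic_division m (x : R) (t : m.-tuple RT) :
  ((Poly (t : seq R) * 'X)^`().[x] = (Poly (synthetic_quotient x t : seq R)).[x])%R.
Proof.
have /(congr1 (fun p => p^`().[x]%R)) := synthetic_divisionP x t.
rewrite derivB derivC subr0 => ->.
by rewrite derivM derivXsubC !hornerE subrr mul0r addr0.
Qed.

Lemma measurable_root_sum_tuple m (h : m.-tuple RT -> RT -> \bar R) :
  measurable_fun setT (fun z : m.-tuple RT * RT => h z.1 z.2) ->
  measurable_fun setT (fun a : m.-tuple RT => root_sum (Poly (a : seq R)) (h a)).
Proof.
move=> mh; apply: (measurable_root_sum (q := fun a : m.-tuple RT => Poly (a : seq R)) (M := m)) => // [t|a].
  exact: (measurable_fun_fixl (f := fun (x : RT) (a : m.-tuple RT) =>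
    (Poly (a : seq R)).[x])%R (@measurable_horner_Poly m) t).
by rewrite (leq_trans (size_Poly _))// size_tuple.
Qed.

(** With the nonconstant coefficients fixed, the area formula in the constant one replaces the sum
    over zeros by an integral over [x]. With [x] fixed, the passage to the quotient preserves
    Lebesgue measure. *)
Lemma integral_deflation m (H : RT -> m.-tuple RT -> \bar R) :
  measurable_fun setT (fun z : RT * m.-tuple RT => H z.1 z.2) ->
  (forall x b, 0 <= H x b) ->
  \int[lebesgue_tuple R m.+1]_a root_sum (Poly (a : seq R))
     (fun x => H x (synthetic_quotient x [tuple of behead a])) =
  \int[mu]_x \int[lebesgue_tuple R m]_b (`|(Poly (b : seq R)).[x]|%:E * H x b).
Proof.
move=> mH H0.
have mHsq : measurable_fun setT
    (fun z : RT * m.-tuple RT => H z.1 (synthetic_quotient z.1 z.2)).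
  apply: (measurableT_comp (g := fun z : RT * m.-tuple RT =>
    (z.1, synthetic_quotient z.1 z.2)) mH).
  by apply: measurable_fun_pair => //; exact: measurable_synthetic_quotient.
rewrite integral_lebesgue_tupleS_swap; last 2 first.
- apply: (@measurable_root_sum_tuple m.+1 (fun a x =>
    H x (synthetic_quotient x [tuple of behead a]))).
  apply: (measurableT_comp (g := fun z : m.+1.-tuple RT * RT =>
    (z.2, [tuple of behead z.1])) mHsq).
  apply: measurable_fun_pair; first exact: measurable_snd.
  exact: (measurableT_comp (@measurable_behead _ RT m) measurable_fst).
- by move=> t; apply: root_sum_ge0.
under eq_integral => t _.
  have tE a : [tuple of behead (tcons (a, t))] = t by apply: val_inj.
  under eq_integral => a _ do rewrite tE /= cons_poly_def.
  rewrite (area_formula (Poly t * 'X)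
    (g := fun x => H x (synthetic_quotient x t))) => [||x]; last 2 first.
  - exact: (measurable_fun_fixr (f := fun x t => H x (synthetic_quotient x t))).
  - exact: H0.
  under eq_integral do rewrite deriv_synthetic_division.
  over.
have mG : measurable_fun setT (fun z : RT * m.-tuple RT =>
    `|(Poly (z.2 : seq R)).[z.1]|%:E * H z.1 z.2).
  apply: emeasurable_funM => //; apply/measurable_EFinP.
  by apply: measurableT_comp => //; exact: measurable_horner_Poly.
have mGsq : measurable_fun setT (fun z : RT * m.-tuple RT =>
    `|(Poly (synthetic_quotient z.1 z.2 : seq R)).[z.1]|%:E *
    H z.1 (synthetic_quotient z.1 z.2)).
  apply: (measurableT_comp (g := fun z : RT * m.-tuple RT =>
    (z.1, synthetic_quotient z.1 z.2)) mG).
  by apply: measurable_fun_pair => //; exact: measurable_synthetic_quotient.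
have := fubini_tonelli (m1 := mu) (m2 := lebesgue_tuple R m) _ mGsq.
move=> /= <- => [|z]; last by rewrite mule_ge0.
apply: eq_integral => x _.
apply: (@integral_synthetic_quotient R m x (fun b => `|(Poly (b : seq R)).[x]|%:E * H x b)).
  exact: (@measurable_fun_fixl _ _ _ RT (m.-tuple RT) _
    (fun x b => `|(Poly (b : seq R)).[x]|%:E * H x b) mG x).
by move=> b; rewrite mule_ge0.
Qed.

End deflation.

(** * Polynomials with prescribed zeros *)

Section with_roots.
Context (R : realType).
Local Notation RT := (measurableTypeR R).

(** With the length written [k + m], adding one zero gives [(k + m).+1] by computation and
    inductions on [k] need no casts. *)
Definition with_roots k m (x : k.-tuple RT) (t : m.-tuple RT) : (k + m).-tuple RT :=
  [tuple (\prod_(y <- (x : seq R)) ('X - y%:P) * Poly (t : seq R))`_i | i < (k + m)%N].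

(** Absolute Jacobian determinant of [with_roots] in [(x, t)]: a Vandermonde factor times the values
    of the cofactor at the prescribed zeros. *)
Definition jacobian k m (x : k.-tuple RT) (t : m.-tuple RT) : R :=
  (\prod_(i < k) \prod_(j < k | (i < j)%N) `|tnth x i - tnth x j|) *
  \prod_(i < k) `|(Poly (t : seq R)).[tnth x i]|.

Lemma Poly_coef_tuple N (p : {poly R}) : (size p <= N)%N ->
  Poly ([tuple p`_i | i < N] : seq R) = p.
Proof.
move=> pN; apply/polyP => i; rewrite coef_Poly.
have [iN|Ni] := ltnP i N.
  by rewrite -[i]/(nat_of_ord (Ordinal iN)) -tnth_nth tnth_mktuple.
by rewrite !nth_default ?(leq_trans pN)// size_tuple.
Qed.

Lemma Poly_with_roots k m (x : k.-tuple RT) (t : m.-tuple RT) :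
  Poly (with_roots x t : seq R) =
  \prod_(y <- (x : seq R)) ('X - y%:P) * Poly (t : seq R).
Proof.
apply: Poly_coef_tuple; rewrite (leq_trans (size_polyMleq _ _))//.
rewrite size_prod_XsubC size_tuple addSn/= leq_add2l.
by rewrite (leq_trans (size_Poly _))// size_tuple.
Qed.

Lemma with_roots0 m (x : 0.-tuple RT) (t : m.-tuple RT) : with_roots x t = t.
Proof.
apply: eq_from_tnth => i; rewrite tnth_mktuple tuple0 big_nil mul1r coef_Poly.
by rewrite (tnth_nth (0 : R)).
Qed.

Lemma with_roots_cons k m y (x : k.-tuple RT) (t : m.-tuple RT) :
  with_roots (tcons (y, x)) t = with_roots [tuple y] (with_roots x t).
Proof.
apply: eq_from_tnth => i; rewrite !tnth_mktuple Poly_with_roots /=.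
by rewrite big_cons big_seq1 mulrA.
Qed.

(** As [x] is a zero, the constant coefficient of [a] is the one forced by [synthetic_divisionP], so
    the quotient and [x] recover [a]. *)
Lemma with_roots_deflation m (a : m.+1.-tuple RT) (x : R) :
  root (Poly (a : seq R)) x ->
  with_roots [tuple x] (synthetic_quotient x [tuple of behead a]) = a.
Proof.
rewrite (tuple_eta a) -[[tuple of _]]/(tcons (thead a, [tuple of behead a])).
move: (thead a) [tuple of behead a] => c s.
rewrite rootE /= cons_poly_def !hornerE addr_eq0 => /eqP cE.
apply: eq_from_tnth => i; rewrite tnth_mktuple big_seq1.
have -> : [tuple of behead (tcons (c, s))] = s by apply: val_inj.
rewrite -synthetic_divisionP cE polyCN opprK -[_ + _]/(_ * 'X + c%:P).
by rewrite -cons_poly_def -[cons_poly _ _]/(Poly (c :: s)) coef_Poly (tnth_nth (0 : R)).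
Qed.

(** The weight for extracting [y] is the quotient evaluated at [y]; it splits into the distances
    from [y] to the other zeros and the value of [t] at [y]. *)
Lemma jacobian_cons k m y (x : k.-tuple RT) (t : m.-tuple RT) :
  jacobian (tcons (y, x)) t =
  `|(Poly (with_roots x t : seq R)).[y]| * jacobian x t.
Proof.
rewrite /jacobian Poly_with_roots hornerM normrM horner_prod normr_prod.
rewrite !big_ord_recl /= [X in X * _ * _](_ : _ = \prod_(j <- (x : seq R)) `|y - j|); last first.
  rewrite big_mkcond big_ord_recl /= mul1r big_tuple.
  by apply: eq_bigr => j _; rewrite tnthS.
rewrite [X in _ * X * _](_ : _ =
    \prod_(i < k) \prod_(j < k | (i < j)%N) `|tnth x i - tnth x j|); last first.
  apply: eq_bigr => i _; rewrite big_mkcond big_ord_recl /= mul1r [RHS]big_mkcond.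
  by apply: eq_bigr => j _; rewrite !tnthS.
rewrite [X in _ * (_ * X)](_ : _ = \prod_(i < k) `|(Poly (t : seq R)).[tnth x i]|); last first.
  by apply: eq_bigr => i _; rewrite tnthS.
rewrite [\prod_(j <- _) `|(_).[y]|](_ : _ = \prod_(j <- (x : seq R)) `|y - j|); last first.
  by apply: eq_bigr => j _; rewrite !hornerE.
rewrite mulrACA; congr (_ * _ * _).
Qed.

Lemma jacobian_ge0 k m (x : k.-tuple RT) (t : m.-tuple RT) : 0 <= jacobian x t.
Proof. by rewrite mulr_ge0// prodr_ge0// => i _; rewrite prodr_ge0. Qed.

Lemma measurable_with_roots k m : measurable_fun setT
  (fun z : k.-tuple RT * m.-tuple RT => with_roots z.1 z.2).
Proof.
(* An arbitrary list of indices allows an induction that multiplies by one linear factor at a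
   time. *)
have mcoef (s : seq 'I_k) i : measurable_fun setT
  (fun z : k.-tuple RT * m.-tuple RT =>
    (\prod_(j <- s) ('X - (tnth z.1 j : R)%:P) * Poly (z.2 : seq R))`_i).
  elim: s i => [|j s IHs] i.
    under eq_fun do rewrite big_nil mul1r coef_Poly.
    apply: (measurableT_comp (f := fun t : m.-tuple RT => nth (0 : R) t i)
      (g := snd)) => //.
    exact: measurable_nth_tuple.
  under eq_fun do rewrite big_cons -mulrA mulrBl coefB coefXM mul_polyC coefZ.
  apply: measurable_funB.
    by case: i => //= i; exact: IHs.
  apply: measurable_funM => //.
  apply: (measurableT_comp (f := fun x : k.-tuple RT => (tnth x j : R)) (g := fst)) => //.
  exact: measurable_tnth.
apply/measurable_fun_tnthP => i.
apply: eq_measurable_fun (mcoef (enum 'I_k) i) => z _ /=.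
by rewrite tnth_mktuple big_enum big_tuple.
Qed.

Lemma measurable_jacobian k m : measurable_fun setT
  (fun z : k.-tuple RT * m.-tuple RT => jacobian z.1 z.2).
Proof.
have mtnth i : measurable_fun setT (fun z : k.-tuple RT * m.-tuple RT => tnth z.1 i : R).
  apply: (measurableT_comp (f := fun x : k.-tuple RT => (tnth x i : R)) (g := fst)) => //.
  exact: measurable_tnth.
apply: measurable_funM.
  apply: measurable_prod => i _; under eq_fun do rewrite big_mkcond/=.
  apply: measurable_prod => j _; case: (i < j)%N => //.
  by apply: measurableT_comp => //; exact: measurable_funB.
apply: measurable_prod => i _; apply: measurableT_comp => //.
apply: (measurableT_comp (g := fun z : k.-tuple RT * m.-tuple RT => (tnth z.1 i, z.2))
  (@measurable_horner_Poly R m)).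
by apply: measurable_fun_pair => //; exact: mtnth.
Qed.

End with_roots.

(** * Products of zero counts in disjoint sets *)

Lemma integral_indic_mul d (T : measurableType d) (R : realType)
    (mu : {measure set T -> \bar R}) (D : set T) (g : T -> \bar R) :
  (\int[mu]_(x in D) g x = \int[mu]_x ((\1_D x)%:E * g x))%E.
Proof.
rewrite integral_mkcond; apply: eq_integral => x _.
by rewrite patchE indicE; case: ifP => _; rewrite ?mul1e ?mul0e.
Qed.

Lemma emeasurable_prod d (T : measurableType d) (R : realType) (D : set T)
    (I : Type) (s : seq I) (h : I -> T -> \bar R) :
  (forall i, measurable_fun D (h i)) ->
  measurable_fun D (fun x => \prod_(i <- s) h i x)%E.
Proof.
move=> mh; elim: s => [|i s IHs].
  by under eq_fun do rewrite big_nil; exact: measurable_cst.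
by under eq_fun do rewrite big_cons; exact: emeasurable_funM.
Qed.

Section root_counts.
Context (R : realType).
Local Open Scope ereal_scope.
Local Notation RT := (measurableTypeR R).
Local Notation mu := (@lebesgue_measure R).

(** Zeros are counted without multiplicity, and the zero polynomial has count 0. *)
Definition root_count (p : {poly R}) (B : set R) : \bar R :=
  root_sum p (fun x => (\1_B x)%:E).

Lemma root_count_ge0 p B : 0 <= root_count p B.
Proof. by apply: root_sum_ge0 => x; rewrite lee_fin. Qed.

(** The linear factor can only add the zero [x], which lies outside [B]. This is how disjointness of
    the sets enters. *)
Lemma root_count_XsubCM (q : {poly R}) (x : R) (B : set R) : ~ B x ->
  root_count (('X - x%:P) * q)%R B = root_count q B.
Proof.
move=> Bx; rewrite /root_count /root_sum.
have [->|q0] := eqVneq q 0%R; first by rewrite mulr0.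
under eq_bigr do rewrite indicE.
under [RHS]eq_bigr do rewrite indicE.
have E s : \sum_(z <- s) (z \in B)%:R%:E = \sum_(z <- [seq z <- s | z \in B]) 1%:E :> \bar R.
  rewrite big_filter [RHS]big_mkcond; apply: eq_bigr => z _.
  by case: ifP.
rewrite !E; apply: perm_big; apply: uniq_perm.
- by rewrite filter_uniq// uniq_roots.
- by rewrite filter_uniq// uniq_roots.
move=> z; rewrite !mem_filter; have [/set_mem zB /=|//] := boolP (z \in B).
rewrite !mem_rootsR q0 mulf_neq0 ?polyXsubC_eq0//= rootM root_XsubC.
by case: eqVneq => // zx; rewrite zx in zB.
Qed.

Lemma measurable_root_count m (B : set RT) : measurable B ->
  measurable_fun setT (fun a : m.-tuple RT => root_count (Poly (a : seq R)) B).
Proof.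
move=> mB; apply: (@measurable_root_sum_tuple R m (fun _ x => (\1_B x)%:E)).
apply/measurable_EFinP.
apply: (measurableT_comp (f := \1_B : RT -> R) (g := @snd (m.-tuple RT) RT)) => //.
Qed.

Definition tuple_box k (B : 'I_k -> set RT) : set (k.-tuple RT) :=
  [set x | forall i, B i (tnth x i)].

Lemma measurable_tuple_box k (B : 'I_k -> set RT) : (forall i, measurable (B i)) ->
  measurable (tuple_box B).
Proof.
move=> mB; rewrite (_ : tuple_box B = \bigcap_(i in [set: 'I_k])
    ((@tnth k RT) ^~ i @^-1` B i)).
  apply: fin_bigcap_measurable => // i _.
  by rewrite -[X in measurable X]setTI; exact: measurable_tnth.
by apply/seteqP; split => t /= h i => [_|]; exact: h.
Qed.

Lemma tuple_box0 (B : 'I_0 -> set RT) : tuple_box B = setT.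
Proof. by apply/seteqP; split=> // x _ []. Qed.

Lemma indic_tuple_box_cons k (B : 'I_k.+1 -> set RT) x (y : k.-tuple RT) :
  (\1_(tuple_box B) (tcons (x, y)) =
   \1_(B ord0) x * \1_(tuple_box (fun i => B (lift ord0 i))) y :> R)%R.
Proof.
rewrite !indicE -natrM mulnb; congr (nat_of_bool _)%:R.
apply/idP/andP => [/set_mem h|[/set_mem h0 /set_mem h]].
  split; apply/mem_set; first exact: (h ord0).
  by move=> i; have := h (lift ord0 i); rewrite tnthS.
apply/mem_set => i; case: (unliftP ord0 i) => [j ->|->//]; rewrite tnthS.
exact: h.
Qed.

Section density.
Variables (k m : nat) (F : (k + m).-tuple RT -> \bar R).
Hypotheses (mF : measurable_fun setT F) (F0 : forall a, 0 <= F a).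

Lemma measurable_with_roots_integrand : measurable_fun setT
  (fun z : k.-tuple RT * m.-tuple RT =>
    F (with_roots z.1 z.2) * (jacobian z.1 z.2)%:E).
Proof.
apply: emeasurable_funM; last first.
  by apply/measurable_EFinP; exact: measurable_jacobian.
exact: (measurableT_comp mF (@measurable_with_roots R k m)).
Qed.

Lemma with_roots_integrand_ge0 (x : k.-tuple RT) (t : m.-tuple RT) :
  0 <= F (with_roots x t) * (jacobian x t)%:E.
Proof. by rewrite mule_ge0// lee_fin jacobian_ge0. Qed.

Lemma measurable_with_roots_density : measurable_fun setT
  (fun x : k.-tuple RT => \int[lebesgue_tuple R m]_t
    (F (with_roots x t) * (jacobian x t)%:E)).
Proof.
apply: (measurable_fun_fubini_tonelli_F _ measurable_with_roots_integrand).
by move=> z; exact: with_roots_integrand_ge0.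
Qed.

End density.

(** Induction on [k], extracting the zero in the first set. The weight [F] is arbitrary so that it
    can absorb the factor produced by each extraction. *)
Lemma integral_root_counts k m (F : (k + m).-tuple RT -> \bar R)
    (B : 'I_k -> set RT) :
  measurable_fun setT F -> (forall a, 0 <= F a) ->
  (forall i, measurable (B i)) -> trivIset setT B ->
  \int[lebesgue_tuple R (k + m)]_a
    (F a * \prod_(i < k) root_count (Poly (a : seq R)) (B i)) =
  \int[lebesgue_tuple R k]_(x in tuple_box B)
    \int[lebesgue_tuple R m]_t (F (with_roots x t) * (jacobian x t)%:E).
Proof.
elim: k F B => [|k IHk] F B mF F0 mB tB.
  rewrite tuple_box0 integral_lebesgue_tuple0; last exact: measurable_with_roots_density.
  apply: eq_integral => t _; rewrite big_ord0 with_roots0 /jacobian !big_ord0.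
  by rewrite mulr1.
pose B' i := B (lift ord0 i).
have mB' i : measurable (B' i) by exact: mB.
have tB' : trivIset setT B'.
  apply/trivIsetP => i j _ _ ij; move/trivIsetP : tB => /(_ (lift ord0 i) (lift ord0 j)).
  by apply => //; apply: contra ij => /eqP/lift_inj ->.
pose H (x : RT) (b : (k + m).-tuple RT) : \bar R :=
  (\1_(B ord0) x)%:E * (F (with_roots [tuple x] b) *
    \prod_(i < k) root_count (Poly (b : seq R)) (B' i)).
have P0 b : 0 <= \prod_(i < k) root_count (Poly (b : seq R)) (B' i).
  by apply: prode_ge0 => i _; exact: root_count_ge0.
have H0 x b : 0 <= H x b by rewrite !mule_ge0// lee_fin.
have mw : measurable_fun setT (fun z : RT * (k + m).-tuple RT =>
    F (with_roots [tuple z.1] z.2)).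
  apply: (measurableT_comp mF).
  apply: (measurableT_comp (f := fun z : 1.-tuple RT * (k + m).-tuple RT => with_roots z.1 z.2)
    (g := fun z : RT * (k + m).-tuple RT => ([tuple z.1], z.2))).
    exact: measurable_with_roots.
  apply: measurable_fun_pair => //; apply/measurable_fun_tnthP => i.
  by apply: (eq_measurable_fun fst) => // z _; rewrite ord1 /= tnth0.
have mP : measurable_fun setT (fun b : (k + m).-tuple RT =>
    \prod_(i < k) root_count (Poly (b : seq R)) (B' i)).
  by apply: emeasurable_prod => i; exact: measurable_root_count.
have mH : measurable_fun setT (fun z : RT * (k + m).-tuple RT => H z.1 z.2).
  apply: emeasurable_funM.
    apply/measurable_EFinP.
    by apply: (measurableT_comp (f := \1_(B ord0) : RT -> R) (g := @fst RT _)).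
  apply: emeasurable_funM => //.
  exact: (measurableT_comp mP measurable_snd).
(* The count in [B ord0] is expanded over the zeros [x] in that set. By disjointness the other
   counts can be read off the quotient, which brings the integrand to the form required by
   [integral_deflation]. *)
transitivity (\int[lebesgue_tuple R (k + m).+1]_a root_sum (Poly (a : seq R))
     (fun x => H x (synthetic_quotient x [tuple of behead a]))).
  apply: eq_integral => a _; rewrite big_ord_recl [root_count _ _]/root_count.
  rewrite /root_sum ge0_sume_distrl; last by move=> i _; rewrite lee_fin.
  rewrite ge0_sume_distrr; last first.
    by move=> i _; rewrite mule_ge0 ?lee_fin// prode_ge0// => j _; exact: root_count_ge0.
  apply: eq_big_seq => x; rewrite mem_rootsR => /andP[_ rx].
  rewrite /H with_roots_deflation//.
  have [/set_mem xB|] := boolP (x \in B ord0); last first.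
    by move=> /negPf xB; rewrite !indicE xB !mul0e mule0.
  rewrite !indicE mem_set// !mul1e; congr (_ * _).
  apply: eq_bigr => i _; rewrite -{1}(with_roots_deflation rx) Poly_with_roots big_seq1.
  apply: root_count_XsubCM => xB'.
  by have /trivIsetP/(_ ord0 (lift ord0 i) I I isT) := tB; rewrite -subset0 => /(_ x); apply.
rewrite (integral_deflation mH H0) [RHS]integral_indic_mul [RHS]integral_lebesgue_tupleS; last 2 first.
- apply: emeasurable_funM; last exact: measurable_with_roots_density.
  by apply/measurable_EFinP; apply: measurable_indic; exact: measurable_tuple_box.
- move=> x; rewrite mule_ge0 ?lee_fin// integral_ge0// => t _.
  exact: with_roots_integrand_ge0.
apply: eq_integral => x _.
under [RHS]eq_integral => y _.
  rewrite indic_tuple_box_cons EFinM -muleA.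
  under eq_integral => t _ do rewrite jacobian_cons with_roots_cons EFinM.
  over.
have [xB|/negPf xB] := boolP (x \in B ord0); last first.
  by rewrite !integral0_eq// => t _; rewrite /H indicE xB mul0e ?mule0.
(* The new weight is the old one at the polynomial with [x] put back, times the weight of the
   extraction. *)
have IH := IHk (fun b => F (with_roots [tuple x] b) * `|(Poly (b : seq R)).[x]|%:E) B' _ _ mB' tB'.
under [RHS]eq_integral => y _.
  rewrite indicE xB mul1e; under eq_integral do rewrite muleA.
  over.
rewrite -integral_indic_mul -IH.
- by apply: eq_integral => b _; rewrite /H indicE xB mul1e muleCA !muleA.
- apply: emeasurable_funM.
    exact: (@measurable_fun_fixl _ _ _ RT ((k + m).-tuple RT) _
      (fun x b => F (with_roots [tuple x] b)) mw x).
  apply/measurable_EFinP; apply: measurableT_comp => //.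
  exact: (@measurable_fun_fixl _ _ _ RT ((k + m).-tuple RT) _
    (fun x b => (Poly (b : seq R)).[x])%R (@measurable_horner_Poly R _) x).
- by move=> b; rewrite mule_ge0.
Qed.

End root_counts.

(** * Coefficients in terms of elementary symmetric polynomials *)

Section with_roots_coefficients.
Context (R : realType).
Local Notation RT := (measurableTypeR R).

(** Vieta's formula. If [i < j] the index of [elem_sym] exceeds [k], and if [i - j > k] it is
    negative; no subset has such a cardinality, so both sides vanish. *)
Lemma coef_prod_XsubC_elem_sym k (x : k.-tuple RT) (i j : nat) :
  (\prod_(y <- (x : seq R)) ('X - y%:P) * 'X^j)`_i =
  (-1) ^ (k%:Z - i%:Z + j%:Z) * elem_sym (k%:Z - i%:Z + j%:Z) x.
Proof.
rewrite coefMXn; have [ij|ji] := ltnP i j.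
  rewrite /elem_sym big_pred0 ?mulr0// => A; apply/eqP => Ae.
  have := max_card (mem A); rewrite card_ord.
  have : (k%:Z < #|A|%:Z)%R by rewrite Ae; lia.
  by rewrite ltz_nat ltnNge => /negPf ->.
have [ijk|kij] := leqP (i - j) k; last first.
  rewrite nth_default ?size_prod_XsubC ?size_tuple//.
  rewrite /elem_sym big_pred0 ?mulr0// => A; apply/eqP => Ae.
  by have : (0 <= #|A|%:Z)%R by []; rewrite Ae; lia.
have -> : (k%:Z - i%:Z + j%:Z = (k - (i - j))%N%:Z)%R by lia.
case: x => s sz /=; have ks : k = size s by rewrite (eqP sz).
subst k; rewrite coef_prod_XsubC//.
congr (_ * _); rewrite /elem_sym; apply: eq_big => // A _.
by apply: eq_bigr => l _; rewrite (tnth_nth (0 : R)).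
Qed.

Lemma tnth_with_roots k m (x : k.-tuple RT) (t : m.-tuple RT) (i : 'I_(k + m)) :
  tnth (with_roots x t) i =
  \sum_(j < m) (-1) ^ (k%:Z - i%:Z + j%:Z) *
               elem_sym (k%:Z - i%:Z + j%:Z) x * tnth t j.
Proof.
rewrite tnth_mktuple.
have -> : Poly (t : seq R) = \sum_(j < m) (tnth t j : R) *: 'X^j.
  apply/polyP => l; rewrite coef_Poly coef_sum.
  under eq_bigr => j _ do rewrite coefZ coefXn.
  have [lm|ml] := ltnP l m.
    rewrite (bigD1 (Ordinal lm))//= eqxx mulr1 big1 ?addr0 ?(tnth_nth (0 : R))//.
    by move=> j; rewrite -val_eqE eq_sym /= => /negPf ->; rewrite mulr0.
  rewrite nth_default ?size_tuple// big1// => j _.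
  by rewrite gtn_eqF ?mulr0// (leq_trans (ltn_ord j)).
rewrite mulr_sumr coef_sum; apply: eq_bigr => j _.
by rewrite -scalerAr coefZ coef_prod_XsubC_elem_sym mulrC.
Qed.

Lemma with_roots_integrandE k m (f : 'I_(k + m) -> R -> R)
    (x : k.-tuple RT) (t : m.-tuple RT) :
  \prod_i f i (tnth (with_roots x t) i) * jacobian x t =
  (\prod_(i < k) \prod_(j < k | (i < j)%N) `|tnth x i - tnth x j|) *
  ((\prod_(i < (k + m)%N)
      f i (\sum_(j < m) (-1) ^ (k%:Z - i%:Z + j%:Z) *
             elem_sym (k%:Z - i%:Z + j%:Z) x * tnth t j)) *
   \prod_(i < k) `|\sum_(j < m) tnth t j * tnth x i ^+ j|).
Proof.
rewrite /jacobian mulrCA; congr (_ * (_ * _)).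
  by apply: eq_bigr => i _; rewrite tnth_with_roots.
apply: eq_bigr => i _; rewrite (@horner_Poly_nth _ m) ?size_tuple//.
by congr (Num.norm _); apply: eq_bigr => j _; rewrite [tnth t j](tnth_nth (0 : R)).
Qed.

End with_roots_coefficients.

(** * The law of the coefficient vector *)

Section tuple_law.
Context (R : realType).
Local Open Scope ereal_scope.
Local Notation RT := (measurableTypeR R).

Definition tuple_boxes N : set (set (N.-tuple RT)) :=
  [set tuple_box A | A in [set A | forall i, measurable (A i)]].

Lemma setI_closed_tuple_boxes N : setI_closed (@tuple_boxes N).
Proof.
move=> _ _ [A mA <-] [B mB <-]; exists (fun i => A i `&` B i).
  by move=> i; exact: measurableI.
apply/seteqP; split=> t /= h; first by split=> i; have [] := h i.
by move=> i; split; [exact: h.1|exact: h.2].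
Qed.

(** The generating events constrain one coordinate, so they are boxes whose other sides are the
    whole line. *)
Lemma measurable_tuple_boxes N : @measurable _ (N.-tuple RT) = <<s @tuple_boxes N >>.
Proof.
apply/seteqP; split.
  apply: smallest_sub; first exact: smallest_sigma_algebra.
  move=> A; rewrite -bigcup_seq => -[i _ [B mB <-]]; rewrite setTI.
  apply: sub_sigma_algebra.
  exists (fun j => if j == i then B else setT).
    by move=> j /=; case: ifP.
  apply/seteqP; split=> t /=; first by move=> /(_ i); rewrite eqxx.
  by move=> Bt j; case: eqP => [->|].
apply: smallest_sub; first exact: sigma_algebra_measurable.
by move=> _ [A mA <-]; exact: measurable_tuple_box.
Qed.

Lemma measurable_prod_density N (f : 'I_N -> R -> R) :
  (forall i, measurable_fun setT (f i)) ->
  measurable_fun setT (fun t : N.-tuple RT => \prod_i f i (tnth t i))%R.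
Proof.
move=> mf; apply: measurable_prod => i _.
exact: (measurableT_comp (f := f i : RT -> R) (g := fun t : N.-tuple RT => tnth t i)
  (mf i) (@measurable_tnth _ RT N i)).
Qed.

Lemma integral_tuple_box N (f : 'I_N -> R -> R) (A : 'I_N -> set RT) :
  (forall i, measurable_fun setT (f i)) -> (forall i x, (0 <= f i x)%R) ->
  (forall i, measurable (A i)) ->
  \int[lebesgue_tuple R N]_(t in tuple_box A) (\prod_i f i (tnth t i))%:E =
  \prod_i \int[lebesgue_measure]_(x in A i) (f i x)%:E.
Proof.
move=> mf f0; elim: N f mf f0 A => [|N IHN] f mf f0 A mA.
  rewrite tuple_box0 integral_lebesgue_tuple0 ?big_ord0//.
  by apply/measurable_EFinP; exact: measurable_prod_density.
have mbox n (B : 'I_n -> set RT) : (forall i, measurable (B i)) ->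
    measurable (tuple_box B) by exact: measurable_tuple_box.
rewrite big_ord_recl -(IHN (fun i => f (lift ord0 i)))//.
rewrite integral_indic_mul integral_lebesgue_tupleS; last 2 first.
- apply: emeasurable_funM.
    by apply/measurable_EFinP; apply: measurable_indic; exact: mbox.
  by apply/measurable_EFinP; exact: measurable_prod_density.
- by move=> t; rewrite mule_ge0 ?lee_fin// prodr_ge0.
rewrite [in RHS](integral_indic_mul _ (A ord0)) muleC.
have mtail : measurable_fun setT (fun t : N.-tuple RT =>
    (\prod_(i < N) f (lift ord0 i) (tnth t i))%R).
  exact: (@measurable_prod_density N (fun i => f (lift ord0 i))).
have mbox_tail : measurable (tuple_box (fun i => A (lift ord0 i))) by exact: mbox.
rewrite -ge0_integralZl//; last 3 first.
- by apply: emeasurable_funM; apply/measurable_EFinP => //; exact: mf.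
- by move=> x _; rewrite mule_ge0 ?lee_fin.
- by apply: integral_ge0 => t _; rewrite lee_fin prodr_ge0.
apply: eq_integral => x _; rewrite [in RHS]integral_indic_mul muleC -EFinM.
rewrite -ge0_integralZl_EFin//; last 3 first.
- by move=> t _; rewrite mule_ge0 ?lee_fin// prodr_ge0.
- apply: emeasurable_funM; apply/measurable_EFinP => //.
- by rewrite mulr_ge0.
apply: eq_integral => t _; rewrite indic_tuple_box_cons big_ord_recl.
under [in LHS]eq_bigr do rewrite tnthS.
by rewrite -!EFinM mulrACA.
Qed.

End tuple_law.

Section law.
Context d (T : measurableType d) (R : realType) (P : probability T R).
Variables (N : nat) (xi : 'I_N -> {RV P >-> R}) (f : 'I_N -> R -> R).
Hypotheses (xi_indep : independent_RVs P xi)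
  (xi_density : forall i, has_density P (xi i) (f i)).
Local Open Scope ereal_scope.
Local Notation RT := (measurableTypeR R).

Let X (w : T) : N.-tuple RT := [tuple xi i w | i < N].

(** Independence and the densities make the law of [X] agree with the product density on boxes, a
    generating class closed under intersection; hence the two measures are equal. *)
Lemma integral_random_tuple (H : N.-tuple RT -> \bar R) :
  measurable_fun setT H -> (forall a, 0 <= H a) ->
  \int[P]_w H (X w) = \int[lebesgue_tuple R N]_a ((\prod_i f i (tnth a i))%:E * H a).
Proof.
move=> mH H0.
have mf i : measurable_fun setT (f i) by have [] := xi_density i.
have f0 i x : (0 <= f i x)%R by have [_] := xi_density i.
have mX : measurable_fun setT X.
  apply/measurable_fun_tnthP => i.
  by apply: (eq_measurable_fun (xi i)) => // w _; rewrite /= tnth_mktuple.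
have mphi := measurable_prod_density mf.
have phi0 (a : N.-tuple RT) : (0 <= \prod_i f i (tnth a i))%R by rewrite prodr_ge0.
rewrite -(ge0_integral_density (lebesgue_tuple R N) mphi phi0)//.
have := ge0_integral_pushforward mX P measurableT mH (fun a _ => H0 a).
rewrite preimage_setT => <-.
apply: eq_measure_integral => A mA _.
(* The total mass is finite, so the constant sequence [setT] serves as the exhaustion. *)
apply: (@measure_unique _ R (N.-tuple RT) (@tuple_boxes R N) (fun=> setT) _ _ _ _
  [the measure _ _ of pushforward P X]
  [the measure _ _ of density_measure (lebesgue_tuple R N) mphi phi0]) => //.
- exact: measurable_tuple_boxes.
- exact: setI_closed_tuple_boxes.
- by move=> _; exists (fun=> setT) => //; apply/seteqP; split.
- by apply/seteqP; split=> // a _; exists 0%N.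
- move=> _ [B mB <-]; rewrite /= /density_measure integral_tuple_box// /pushforward.
  (* Independence is applied to the full index set. *)
  rewrite (_ : X @^-1` _ = \bigcap_(i in [set` [set: 'I_N]%SET]) (xi i @^-1` B i)).
    rewrite xi_indep//; apply: eq_big => [i|i _]; first by rewrite finset.in_setT.
    by have [_ _ h] := xi_density i; exact: (h (B i) (mB i)).
  apply/seteqP; split=> w /= h i; last by rewrite tnth_mktuple; apply: h; rewrite /= finset.in_setT.
  by move=> _; have := h i; rewrite tnth_mktuple.
- move=> k; rewrite /= /pushforward preimage_setT.
  by rewrite (le_lt_trans (probability_le1 _ _))// ltry.
Qed.

End law.

(** * Correlation functions of the real zeros *)

Section correlation.
Context d (T : measurableType d) (R : realType) (P : probability T R).
Local Open Scope ereal_scope.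
Local Notation RT := (measurableTypeR R).

Lemma esum_dirac_roots (p : {poly R}) (B : set R) : p != 0%R ->
  \esum_(x in [set x : R | p.[x] = 0%R]) \d_x B = root_count p B.
Proof.
move=> p0; have -> : [set x : R | p.[x] = 0%R] = [set` rootsR p].
  by apply/seteqP; split=> x /=; rewrite mem_rootsR p0 rootE => /eqP.
rewrite esum_fset; [|exact: finite_seq|by move=> x _; exact: measure_ge0].
by rewrite -fsbig_seq ?uniq_roots.
Qed.

(** As a box with sides {0}, the event is measurable and its Lebesgue measure is a product. *)
Lemma Poly_tuple_eq0 N (a : N.-tuple RT) :
  Poly (a : seq R) = 0%R <-> tuple_box (fun=> [set (0 : R)%R]) a.
Proof.
split=> [/polyP a0 i|a0].
  by have := a0 i; rewrite coef_Poly coef0 /= (tnth_nth (0 : R)%R).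
apply/polyP => i; rewrite coef_Poly coef0.
have [iN|Ni] := ltnP i N; last by rewrite nth_default ?size_tuple.
by have := a0 (Ordinal iN); rewrite /= (tnth_nth (0 : R)%R).
Qed.

Lemma Poly_tupleE N (c : 'I_N -> R) :
  Poly ([tuple c i | i < N] : seq R) = (\sum_(i < N) c i *: 'X^i)%R.
Proof.
rewrite -[RHS](@Poly_coef_tuple _ N); last first.
  apply: (leq_trans (size_sum _ _ _)); apply/bigmax_leqP => i _.
  by rewrite (leq_trans (size_scale_leq _ _))// size_polyXn.
congr Poly; congr (val _); apply: eq_from_tnth => i; rewrite !tnth_mktuple.
rewrite coef_sum (bigD1 i)//= coefZ coefXn eqxx mulr1 big1 ?addr0// => j ji.
by rewrite coefZ coefXn eq_sym -[(_ == _)%N]/(j == i) (negPf ji) mulr0.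
Qed.

(** The expectation is an integral over coefficient vectors with the product density, to which
    [integral_root_counts] applies once point masses are replaced by [root_count] almost everywhere.
    The size [m.+1] provides at least one coefficient, so the zero vector is a null set. *)
Lemma is_correlation_function_roots k m (xi : 'I_(k + m.+1) -> {RV P >-> R})
    (f : 'I_(k + m.+1) -> R -> R) :
  independent_RVs P xi ->
  (forall i, has_density P (xi i) (f i)) ->
  is_correlation_function P
    (real_zeros_measure (fun w => \sum_(i < k + m.+1) xi i w *: 'X^i)%R)
    (fun x : k.-tuple RT => \int[lebesgue_tuple R m.+1]_t
      ((\prod_i f i (tnth (with_roots x t) i))%:E * (jacobian x t)%:E)).
Proof.
move=> indep dens.
have mf i : measurable_fun setT (f i) by have [] := dens i.
have f0 i x : (0 <= f i x)%R by have [_] := dens i.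
pose F (a : (k + m.+1).-tuple RT) := (\prod_i f i (tnth a i))%:E.
have mF : measurable_fun setT F by apply/measurable_EFinP; exact: (measurable_prod_density mf).
have F0 a : 0 <= F a by rewrite lee_fin prodr_ge0.
split.
- exact: (measurable_with_roots_density mF F0).
- by move=> x; apply: integral_ge0 => t _; exact: (with_roots_integrand_ge0 F0).
move=> B mB0 tB; have mB i : measurable (B i : set RT) by exact: mB0.
pose H (a : (k + m.+1).-tuple RT) : \bar R :=
  \prod_(i < k) \esum_(x in [set x : R | (Poly (a : seq R)).[x] = 0%R]) \d_x (B i).
pose H' (a : (k + m.+1).-tuple RT) : \bar R :=
  \prod_(i < k) root_count (Poly (a : seq R)) (B i).
pose Z : set ((k + m.+1).-tuple RT) := tuple_box (fun=> [set (0 : R)%R]).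
have mZ : measurable Z by exact: measurable_tuple_box.
have HE a : ~ Z a -> H a = H' a.
  move=> Za; apply: eq_bigr => i _; apply: esum_dirac_roots.
  by apply/eqP => p0; apply: Za; exact/Poly_tuple_eq0.
have mH' : measurable_fun setT H'.
  by apply: emeasurable_prod => i; exact: measurable_root_count.
have mH : measurable_fun setT H.
  (* [H] and [H'] can differ only at the zero vector, where [H] has a single value; this gives its
     measurability. *)
  rewrite (_ : H = fun a => if Poly (a : seq R) == 0%R then H [tuple 0%R | _ < _] else H' a).
    apply: measurable_fun_ifT => //.
    apply: (measurable_fun_bool true); rewrite setTI.
    rewrite (_ : _ @^-1` _ = Z)//; apply/seteqP; split=> a /=.
      by move=> /eqP/Poly_tuple_eq0.
    by move=> /Poly_tuple_eq0/eqP.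
  apply/funext => a; case: eqP => [a0|a0]; last first.
    by apply: eq_bigr => i _; apply: esum_dirac_roots; exact/eqP.
  rewrite /H (_ : Poly ([tuple 0%R | _ < _] : seq R) = 0%R) ?a0//.
  by apply/Poly_tuple_eq0 => i; rewrite tnth_mktuple.
have H0 a : 0 <= H a.
  by apply: prode_ge0 => i _; apply: esum_ge0 => x _; exact: measure_ge0.
have H'0 a : 0 <= H' a.
  by apply: prode_ge0 => i _; exact: root_count_ge0.
rewrite -[RHS](integral_root_counts mF F0 mB tB).
transitivity (\int[P]_w H [tuple xi i w | i < (k + m.+1)%N]).
  apply: eq_integral => w _; apply: eq_bigr => i _.
  by rewrite /real_zeros_measure Poly_tupleE.
rewrite (integral_random_tuple indep dens mH H0).
apply: ge0_ae_eq_integral => //.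
- by apply: emeasurable_funM.
- by apply: emeasurable_funM.
- by move=> a _; apply: mule_ge0; [exact: F0|exact: H0].
- by move=> a _; apply: mule_ge0; [exact: F0|exact: H'0].
(* The zero polynomial, which has infinitely many zeros, is a null event. *)
exists Z; split=> //.
  transitivity (\prod_(i < k + m.+1) lebesgue_measure [set (0 : R)%R]).
    by apply: (@lebesgue_tuple_box R (k + m.+1) (fun=> [set (0 : R)%R])).
  by rewrite (bigD1 (rshift k ord0))//= lebesgue_measure_set1 mul0e.
move=> a /= h; apply: contrapT => Za; apply: h => _.
by rewrite /F HE.
Qed.

End correlation.

Theorem theorem2p3 (R : realType) (d : measure_display) (T : measurableType d)
    (P : probability T R) (n : nat) (xi : 'I_n.+1 -> {RV P >-> R})
    (f : 'I_n.+1 -> R -> R) (k : nat) :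
  (1 <= n)%N ->
  independent_RVs P xi ->
  (forall i, has_density P (xi i) (f i)) ->
  (1 <= k <= n)%N ->
  is_correlation_function P (real_zeros_measure (random_poly (fun i => xi i)))
    (fun x : k.-tuple (measurableTypeR R) =>
      ((\prod_(i < k) \prod_(j < k | (i < j)%N) `|tnth x i - tnth x j|)%:E *
       \int[lebesgue_tuple R (n - k).+1]_t
         ((\prod_(i < n.+1)
             f i (\sum_(j < (n - k).+1)
                    (-1) ^ (k%:Z - i%:Z + j%:Z) *
                    elem_sym (k%:Z - i%:Z + j%:Z) x * tnth t j)) *
          (\prod_(i < k)
             `| \sum_(j < (n - k).+1) tnth t j * tnth x i ^+ j |))%:E)%E).
Proof.
move=> _ indep dens /andP[_ kn]; rewrite /random_poly.
have nk : n.+1 = (k + (n - k).+1)%N by rewrite addnS subnKC.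
(* [n.+1] is generalized along with the families it indexes, so that rewriting with [nk] changes
   their types without casts. *)
move: (n - k)%N nk => m nk; move: (n.+1) nk xi f indep dens => N ->.
move=> xi f indep dens.
rewrite (_ : (fun x => _) = (fun x : k.-tuple (measurableTypeR R) =>
    \int[lebesgue_tuple R m.+1]_t
      ((\prod_i f i (tnth (with_roots x t) i))%:E * (jacobian x t)%:E))%E).
  exact: is_correlation_function_roots.
apply/funext => x.
(* The product of the distances does not depend on [t] and leaves the integral. *)
under [RHS]eq_integral => t _ do rewrite -EFinM with_roots_integrandE EFinM.
rewrite ge0_integralZl_EFin//.
- move=> t _; rewrite lee_fin mulr_ge0// prodr_ge0// => i _.
  by have [_] := dens i.
- apply/measurable_EFinP; apply: measurable_funM; apply: measurable_prod => i _.
    have [mf _ _] := dens i.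
    apply: (measurableT_comp (f := f i) mf); apply: measurable_sum => j.
    by apply: measurable_funM => //; exact: measurable_tnth.
  apply: measurableT_comp => //; apply: measurable_sum => j.
  by apply: measurable_funM => //; exact: measurable_tnth.
- by rewrite prodr_ge0// => i _; rewrite prodr_ge0.
Qed.
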